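(* Let $E$ be a hybrid time domain and $A,B:E\to\mathbb R^{p\times p}$. Suppose: (i) $A(t,j)=A(t,j)^\top\ge0$ for all $(t,j)\in E$; $B(t,j)=B(t,j)^\top\ge0$ for all $(t,j)\in\Upsilon(E)$; there exists $a_M>0$ such that $\operatorname{ess\,sup}\{|A(t,j)|:(t,j)\in E\}\le a_M$; and $|B(t,j)|<1$ for all $(t,j)\in\Upsilon(E)$. (ii) There exist $\Delta,\mu_0>0$ such that, for each $(t',j'),(t^*,j^* )\in E$ satisfying $\Delta\le(t^*-t')+(j^*-j')<\Delta+1$, $$\sum_{j=j'}^{j^*}\int_{\max\{t',t_j\}}^{\min\{t^*,t_{j+1}\}}A(s,j)\,ds+\frac12\sum_{j=j'}^{j^*-1}B(t_{j+1},j)\ \ge\ \mu_0I,$$ where $\{t_j\}_{j=0}^J$ is the sequence defining $E$, $J:=\sup_jE$, and $t_{J+1}:=T:=\sup_tE$. Then, for each $q_M\ge q_m>0$ and each symmetric matrix function $Q:E\to\mathbb R^{p\times p}$ satisfying $q_mI\le Q(t,j)\le q_MI$ for all $(t,j)\in E$, there exists a symmetric matrix function $P:E\to\mathbb R^{p\times p}$ satisfying $$p_mI\le P(t,j)\le p_MI\qquad\text{for all }(t,j)\in E,$$ where $$p_m:=q_m,\qquad p_M:=q_m+\frac{q_M\kappa_0^2}{2\lambda_0}+\frac{q_M\kappa_0^2e^{2\lambda_0}}{e^{2\lambda_0}-1},\qquad \kappa_0:=\sqrt{\tfrac1{1-\sigma}},\qquad\lambda_0:=-\frac{\ln(1-\sigma)}{2(\Delta+1)},$$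 $$\sigma:=\frac{2\mu_0}{\big(1+\sqrt{(a_M+2)(\Delta+2)^3(a_M(\Delta+2)+1/2)}\big)^2}.$$ Moreover, for each $j\in\mathbb N$ and almost all $t\in I^j:=\{t:(t,j)\in E\}$, $$\frac{d}{dt}P(t,j)-P(t,j)A(t,j)-A(t,j)^\top P(t,j)\le-Q(t,j),$$ and, for all $(t,j)\in\Upsilon(E)$, $$(I-B(t,j))^\top P(t,j+1)(I-B(t,j))-P(t,j)\le-Q(t,j).$$
   Context: A set $E\subset\mathbb R_{\ge0}\times\mathbb N$ is a hybrid time domain if for every $(T',J')\in E$ there is a nondecreasing sequence $\{t_j\}_{j=0}^{J'+1}$ with $t_0=0$ and $E\cap([0,T']\times\{0,\dots,J'\})=\bigcup_{j=0}^{J'}([t_j,t_{j+1}]\times\{j\})$. $\sup_tE$ and $\sup_jE$ are the suprema of the $t$- and $j$-coordinates of points of $E$. $\Upsilon(E):=\{(t,j)\in E:(t,j+1)\in E\}$. $|\cdot|$ is the induced (spectral) matrix norm; matrix inequalities are in the positive-semidefinite order. In the paper $A,B$ are the data of the hybrid system with state $(\vartheta,\tau,k)\in\mathbb R^p\times E$, flows $\dot\vartheta=-A(\tau,k)\vartheta$, $\dot\tau=1$, $\dot k=0$, and jumps $\vartheta^+=\vartheta-B(\tau,k)\vartheta$, $\tau^+=\tau$, $k^+=k+1$ when $(\tau,k+1)\in E$.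
   Formalization: Assumes σ<1 (automatic for p>0 once (ii) applies to some pair; otherwise μ0 is unconstrained and κ0, λ0 may be undefined), that E has a single defining sequence {t_j} (branching sets have none), and that A(·,j) is Lebesgue measurable, as the integrals in (ii) require. *)

(* Defs.v *)
From HB Require Import structures.
From mathcomp Require Import all_boot all_order all_algebra.
From mathcomp Require Import all_classical all_reals all_analysis measurable_realfun.

Set Implicit Arguments.
Unset Strict Implicit.
Unset Printing Implicit Defensive.

Import Order.TTheory GRing.Theory Num.Theory.
Import numFieldNormedType.Exports.

Local Open Scope classical_set_scope.
Local Open Scope ring_scope.

Section Matrices.
Context {R : realType} {p : nat}.
Implicit Types (M N : 'M[R]_p) (x : 'cV[R]_p).

Definition psd M : Prop :=
  M^T = M /\ forall x, 0 <= (x^T *m M *m x) 0 0.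

Definition psd_le M N : Prop := psd (N - M).

Definition eucl_norm x : R := Num.sqrt (\sum_i x i 0 ^+ 2).

(* The canonical norm `|M| of the library is the entrywise maximum. *)
Definition spectral_norm M : R :=
  sup [set eucl_norm (M *m x) | x in [set x | eucl_norm x <= 1]].

(* Matrix-valued Lebesgue integral. The completed measure is used because the
   integrand is only assumed to be Lebesgue (not Borel) measurable. *)
Definition mx_integral (D : set R) (F : R -> 'M[R]_p) : 'M[R]_p :=
  \matrix_(k, l) Rintegral (@completed_lebesgue_measure R) D (fun s => F s k l).

End Matrices.

(* [lebesgue_measurable_fun D f]: f is Lebesgue measurable on D. The sets
   [completed_algebra_gen lebesgue_measure] are the Lebesgue measurable sets
   (a Borel set united with a negligible set). *)
Definition lebesgue_measurable_fun {R : realType} (D : set R) (f : R -> R) :=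
  forall Y : set R, measurable Y ->
    completed_algebra_gen (@lebesgue_measure R) (D `&` f @^-1` Y).

Section HybridTimeDomain.
Context {R : realType}.
Implicit Type E : set (R * nat).

Definition hybrid_time_domain E : Prop :=
  (forall t j, E (t, j) -> 0 <= t) /\
  forall T' J', E (T', J') -> exists t : nat -> R,
    [/\ t 0%N = 0,
        forall j, (j <= J')%N -> t j <= t j.+1
      & E `&` ([set s | 0 <= s <= T'] `*` [set j | (j <= J')%N]) =
        \bigcup_(j in [set j | (j <= J')%N])
          ([set s | t j <= s <= t j.+1] `*` [set j])].

Definition sup_t E : \bar R := ereal_sup [set (x.1)%:E | x in E].

Definition sup_j E : \bar R := ereal_sup [set (x.2%:R)%:E | x in E].

(* I^j *)
Definition flow_interval E (j : nat) : set R := [set t | E (t, j)].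

(* The set Upsilon(E) of hybrid times at which a jump occurs. *)
Definition jump_set E : set (R * nat) :=
  [set x | E x /\ E (x.1, x.2.+1)].

(* [jump_times E t]: t is the sequence defining E, with J := sup_j E and, when
   J is finite, t (J + 1) := sup_t E. It is extended-real valued because
   sup_t E may be infinite; the values t j with j > J + 1 are irrelevant. The
   minimum with T' truncates the last interval, which may be unbounded or open
   on the right. *)
Definition jump_times E (t : nat -> \bar R) : Prop :=
  [/\ t 0%N = 0%E,
      forall j : nat, ((j%:R)%:E <= sup_j E)%E -> (t j <= t j.+1)%E,
      forall T' J', E (T', J') ->
        E `&` ([set s | 0 <= s <= T'] `*` [set j | (j <= J')%N]) =
        \bigcup_(j in [set j | (j <= J')%N])
          ([set s | (t j <= s%:E <= mine T'%:E (t j.+1))%E] `*` [set j])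
    & forall J : nat, sup_j E = (J%:R)%:E -> t J.+1 = sup_t E].

(* Essential supremum over E with respect to the product of the Lebesgue
   measure on the t-axis and the counting measure on the j-axis. *)
Definition hybrid_ess_sup E (f : R -> nat -> R) : \bar R :=
  ereal_inf [set y : \bar R | forall j,
    {ae (@lebesgue_measure R), forall t, E (t, j) -> ((f t j)%:E <= y)%E}].

End HybridTimeDomain.

Section PersistenceOfExcitation.
Context {R : realType} {p : nat}.

(* For j in the range of the first sum the bounds of the integral are finite,
   and for j in the range of the second sum t (j + 1) is finite. *)
Definition persistently_exciting (E : set (R * nat)) (t : nat -> \bar R)
    (A B : R -> nat -> 'M[R]_p) (Delta mu0 : R) : Prop :=
  forall (t1 : R) (j1 : nat) (t2 : R) (j2 : nat),
    E (t1, j1) -> E (t2, j2) ->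
    Delta <= (t2 - t1) + (j2%:R - j1%:R) < Delta + 1 ->
    psd_le (mu0%:M)
      (\sum_(j1 <= j < j2.+1)
         mx_integral
           [set s | (maxe t1%:E (t j) <= s%:E <= mine t2%:E (t j.+1))%E]
           (fun s => A s j)
       + 2^-1 *: \sum_(j1 <= j < j2) B (fine (t j.+1)) j).

End PersistenceOfExcitation.

Section Constants.
Context {R : realType}.

Definition sigma (aM Delta mu0 : R) : R :=
  2 * mu0 /
  (1 + Num.sqrt ((aM + 2) * (Delta + 2) ^+ 3 * (aM * (Delta + 2) + 1 / 2)))
    ^+ 2.

Definition kappa0 (aM Delta mu0 : R) : R :=
  Num.sqrt (1 / (1 - sigma aM Delta mu0)).

Definition lambda0 (aM Delta mu0 : R) : R :=
  - ln (1 - sigma aM Delta mu0) / (2 * (Delta + 1)).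

Definition p_M (aM Delta mu0 qm qM : R) : R :=
  let k := kappa0 aM Delta mu0 in
  let l := lambda0 aM Delta mu0 in
  qm + qM * k ^+ 2 / (2 * l)
     + qM * k ^+ 2 * expR (2 * l) / (expR (2 * l) - 1).

End Constants.

(* Main.v *)
(** Transition matrices are not needed: an explicit Lyapunov function works. Put
    the hybrid arc on the axis of the total time [v = t + j], spreading each jump
    over a unit interval, and let [F] be the cumulative excitation, whose
    increments are the sums of integrals of [A] and of halves of [B]. With
    [D = Delta + 2] and [S v] the integral of [F w - F v] for [w] in [[v, v + D]],
    the function [alpha - S] decreases along the arc by at least half the
    increment of [F] over a window, once [alpha] absorbs the cross terms
    [S A + A S]. These are estimated by [S^2 <= |S| S], [A^2 <= |A| A] and
    [S v <= D (F (v + D) - F v)], which costs only one factor [1 / mu0] and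
    leaves room inside [p_M]. Near the end of the domain, where (ii) says
    nothing, a multiple of the remaining hybrid time provides the decrease. As
    [Q <= qM], it suffices to treat [Q = qM]. *)

(* The window length [Delta + 2] has two sources. A jump leaves a gap of length 1 between total
   times of [E], so starting from total time v the excitation is certain only by v + Delta + 1; and
   the decrease across a jump uses only the increment of [F] after the landing time v + 1. The
   Lyapunov matrix is P = (qm + qM rho + c alpha) I - c S, with c = 2 qM / mu0 chosen so that c / 2
   times an excited increment is at least qM I; [rho] is the capped remaining time. Inequalities on
   [S] are proved one vector at a time: x^T F x is a scalar nondecreasing Lipschitz function, and
   everything reduces to its windowed integrals. The analytic obstacle is that [A] is only Lebesgue
   measurable, is bounded only almost everywhere, and lives on intervals that may share endpoints.
   Its pieces are glued into one function and corrected on a null set, which gives a bounded Borel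
   density. Jumps undergo the same construction, as constant densities on unit intervals. *)
Require Import Defs.
From HB Require Import structures.
From mathcomp Require Import all_boot all_order all_algebra.
From mathcomp Require Import all_classical all_reals all_analysis measurable_realfun.
From mathcomp Require Import ring lra.

Set Implicit Arguments.
Unset Strict Implicit.
Unset Printing Implicit Defensive.

Import Order.TTheory GRing.Theory Num.Theory.
Import numFieldNormedType.Exports.

Local Open Scope classical_set_scope.
Local Open Scope ring_scope.

(** * Quadratic forms *)

Section BilinearForms.
Context {R : realType} {p : nat}.
Implicit Types (M N : 'M[R]_p) (x y z : 'cV[R]_p) (a : R).

Definition bform M x y : R := (x^T *m M *m y) 0 0.

Definition sqnorm x : R := (x^T *m x) 0 0.

Lemma bformDm M N x y : bform (M + N) x y = bform M x y + bform N x y.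
Proof. by rewrite /bform mulmxDr mulmxDl mxE. Qed.

Lemma bformZm a M x y : bform (a *: M) x y = a * bform M x y.
Proof. by rewrite /bform -scalemxAr -scalemxAl mxE. Qed.

Lemma bformNm M x y : bform (- M) x y = - bform M x y.
Proof. by rewrite -scaleN1r bformZm mulN1r. Qed.

Lemma bformBm M N x y : bform (M - N) x y = bform M x y - bform N x y.
Proof. by rewrite bformDm bformNm. Qed.

Lemma bform_scalar a x : bform a%:M x x = a * sqnorm x.
Proof. by rewrite /bform /sqnorm mul_mx_scalar -scalemxAl mxE. Qed.

Lemma bformDl M x y z : bform M (x + y) z = bform M x z + bform M y z.
Proof. by rewrite /bform linearD mulmxDl mulmxDl mxE. Qed.

Lemma bformDr M x y z : bform M z (x + y) = bform M z x + bform M z y.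
Proof. by rewrite /bform mulmxDr mxE. Qed.

Lemma bformZl M a x y : bform M (a *: x) y = a * bform M x y.
Proof. by rewrite /bform linearZ -!scalemxAl mxE. Qed.

Lemma bformZr M a x y : bform M x (a *: y) = a * bform M x y.
Proof. by rewrite /bform -scalemxAr mxE. Qed.

Lemma bformNl M x y : bform M (- x) y = - bform M x y.
Proof. by rewrite -scaleN1r bformZl mulN1r. Qed.

Lemma bformNr M x y : bform M x (- y) = - bform M x y.
Proof. by rewrite -scaleN1r bformZr mulN1r. Qed.

Lemma bform_mulr M N x y : bform (M *m N) x y = bform M x (N *m y).
Proof. by rewrite /bform !mulmxA. Qed.

Lemma bform_mull M N x y : bform (M^T *m N) x y = bform N (M *m x) y.
Proof. by rewrite /bform trmx_mul !mulmxA. Qed.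

Lemma bformC M x y : M^T = M -> bform M x y = bform M y x.
Proof.
move=> sM; rewrite /bform; have -> : x^T *m M *m y = (y^T *m M *m x)^T.
  by rewrite !trmx_mul trmxK sM mulmxA.
by rewrite mxE.
Qed.

Lemma sqnormE x : sqnorm x = \sum_i x i 0 ^+ 2.
Proof. by rewrite /sqnorm mxE; apply: eq_bigr => i _; rewrite mxE expr2. Qed.

Lemma sqnorm_ge0 x : 0 <= sqnorm x.
Proof. by rewrite sqnormE sumr_ge0// => i _; rewrite sqr_ge0. Qed.

Lemma sqnorm_mulmx M x : M^T = M -> sqnorm (M *m x) = bform M x (M *m x).
Proof. by move=> sM; rewrite /sqnorm /bform trmx_mul sM. Qed.

Lemma psd_leP M N :
  psd_le M N <-> (N - M)^T = N - M /\ forall x, bform M x x <= bform N x x.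
Proof.
by split=> -[sMN h]; split=> // x; move: (h x);
  rewrite -/(bform _ _ _) bformBm subr_ge0.
Qed.

Lemma bform_entries M x :
  bform M x x = \sum_i \sum_j x i 0 * x j 0 * M i j.
Proof.
rewrite /bform mxE exchange_big/=; apply: eq_bigr => j _.
rewrite mxE mulr_suml; apply: eq_bigr => i _.
by rewrite mxE mulrAC.
Qed.

(* [|Mx|^2 <= a x^T M x] is the positivity of [M] on [x - a^-1 M x]. *)
Lemma sqnorm_mulmx_le M a x : 0 < a -> psd M ->
  (forall y, bform M y y <= a * sqnorm y) ->
  sqnorm (M *m x) <= a * bform M x x.
Proof.
move=> a0 [sM M0] Ma.
have := M0 (x - a^-1 *: (M *m x)); rewrite -/(bform _ _ _).
rewrite !(bformDl, bformDr, bformNl, bformNr, bformZl, bformZr).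
rewrite (bformC (M *m x) x sM) -!sqnorm_mulmx//.
have := Ma (M *m x).
set u := bform M (M *m x) _; set v := sqnorm _; set w := bform _ _ _ => h1 h2.
have h3 : a^-1 * (a^-1 * u) <= a^-1 * v.
  by rewrite ler_pM2l ?invr_gt0// ler_pdivrMl.
have : 0 <= w - a^-1 * v by lra.
by rewrite subr_ge0 ler_pdivrMl.
Qed.

(** Young's inequality: positivity of [M] on y - e x, divided by [e]. Only the [y] term is passed to
    the Euclidean norm; the [x] term is later absorbed as a form. *)
Lemma bform_cross M s e x y : 0 < e -> psd M ->
  (forall z, bform M z z <= s * sqnorm z) ->
  2 * bform M x y <= e * bform M x x + e^-1 * (s * sqnorm y).
Proof.
move=> e0 [sM M0] Ms.
have := M0 (y - e *: x); rewrite -/(bform _ _ _).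
rewrite !(bformDl, bformDr, bformNl, bformNr, bformZl, bformZr).
rewrite (bformC y x sM); have := Ms y.
set u := bform M x y; set v := bform M x x; set w := bform M y y.
set n := s * _ => h1 h2.
have h : e * (2 * u) <= e * (e * v + e^-1 * n).
  by rewrite mulrDr mulVKf ?gt_eqF//; lra.
by move: h; rewrite ler_pM2l.
Qed.

Lemma eucl_normE x : eucl_norm x = Num.sqrt (sqnorm x).
Proof. by rewrite /eucl_norm sqnormE. Qed.

(** Cauchy-Schwarz, from Young's inequality with the optimal weight e = |y| / |x|. When one vector
    vanishes, a suitable [e] contradicts a positive product. *)
Lemma dot_le x y : (x^T *m y) 0 0 <= Num.sqrt (sqnorm x) * Num.sqrt (sqnorm y).
Proof.
have psd1 : psd (1%:M : 'M[R]_p).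
  split; first by rewrite trmx1.
  by move=> z; rewrite mulmx1 sqnorm_ge0.
have e1 u v : (u^T *m v) 0 0 = bform 1%:M u v by rewrite /bform mulmx1.
have H e : 0 < e -> 2 * (x^T *m y) 0 0 <= e * sqnorm x + e^-1 * sqnorm y.
  move=> e0; have := @bform_cross 1%:M 1 e x y e0 psd1.
  rewrite -!e1 -/(sqnorm _) mul1r; apply => z.
  by rewrite -e1 mul1r.
have [x0|x0] := eqVneq (sqnorm x) 0.
  rewrite x0 sqrtr0 mul0r leNgt; apply/negP => xy0.
  pose u := (x^T *m y) 0 0.
  have nu : 0 <= sqnorm y / u by rewrite divr_ge0 ?sqnorm_ge0// ltW.
  have := H (sqnorm y / u + 1) (ltr_wpDl nu ltr01).
  rewrite x0 mulr0 add0r ler_pdivlMl ?ltr_wpDl// -/u.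
  rewrite mulrDl mul1r mulrCA divfK ?gt_eqF//.
  have := sqnorm_ge0 y; rewrite -/u in xy0; lra.
have {}x0 : 0 < sqnorm x by rewrite lt_def x0 sqnorm_ge0.
have [y0|y0] := eqVneq (sqnorm y) 0.
  rewrite y0 sqrtr0 mulr0 leNgt; apply/negP => xy0.
  pose u := (x^T *m y) 0 0.
  have := H (u / sqnorm x) (divr_gt0 xy0 x0).
  rewrite y0 mulr0 addr0 divfK ?gt_eqF// -/u => h.
  by rewrite -/u in xy0; lra.
have {}y0 : 0 < sqnorm y by rewrite lt_def y0 sqnorm_ge0.
have sx : 0 < Num.sqrt (sqnorm x) by rewrite sqrtr_gt0.
have sy : 0 < Num.sqrt (sqnorm y) by rewrite sqrtr_gt0.
have := H _ (divr_gt0 sy sx).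
have := sqr_sqrtr (ltW x0); have := sqr_sqrtr (ltW y0).
move: sx sy; set u := Num.sqrt _; set v := Num.sqrt _ => u0 v0 <- <-.
rewrite invf_div !expr2 mulrA divfK ?gt_eqF// mulrA divfK ?gt_eqF//.
lra.
Qed.

(** Without a bound, [sup] would be a default value and a hypothesis on [spectral_norm] would say
    nothing. Entries of a vector in the unit ball are at most 1 in absolute value, so absolute row
    sums bound the coordinates of [M *m x]. *)
Lemma spectral_norm_has_sup M :
  has_sup [set eucl_norm (M *m x) | x in [set x | eucl_norm x <= 1]].
Proof.
split.
  exists (eucl_norm (M *m 0)); exists 0 => //=.
  by rewrite /eucl_norm big1 ?sqrtr0// => i _; rewrite mxE expr0n.
exists (Num.sqrt (\sum_i (\sum_j `|M i j|) ^+ 2)) => _ [x /= x1 <-].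
rewrite /eucl_norm ler_sqrt ?sumr_ge0//; last by move=> i _; exact: sqr_ge0.
apply: ler_sum => i _.
rewrite -[leLHS]real_normK ?num_real// ler_pXn2r ?nnegrE//.
  rewrite mxE (le_trans (ler_norm_sum _ _ _))//; apply: ler_sum => j _.
  rewrite normrM ler_piMr//.
  rewrite -(@ler_pXn2r _ 2)// ?nnegrE// expr1n real_normK ?num_real//.
  have : sqnorm x <= 1.
    rewrite -[leLHS]sqr_sqrtr ?sqnorm_ge0// -eucl_normE.
    by rewrite exprn_ile1// sqrtr_ge0.
  apply: le_trans; rewrite sqnormE (bigD1 j)//= lerDl.
  by rewrite sumr_ge0// => k _; exact: sqr_ge0.
by rewrite sumr_ge0.
Qed.

Lemma spectral_norm_bform M a x : spectral_norm M <= a ->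
  bform M x x <= a * sqnorm x.
Proof.
move=> Ma.
have key z : bform M z z <= Num.sqrt (sqnorm z) * Num.sqrt (sqnorm (M *m z)).
  by rewrite /bform -mulmxA dot_le.
have [x0|x0] := eqVneq (sqnorm x) 0.
  by have := key x; rewrite x0 sqrtr0 mul0r mulr0.
have {}x0 : 0 < sqnorm x by rewrite lt_def x0 sqnorm_ge0.
have sx : 0 < Num.sqrt (sqnorm x) by rewrite sqrtr_gt0.
pose c := (Num.sqrt (sqnorm x))^-1.
have c0 : 0 < c by rewrite invr_gt0.
have sqZ d z : sqnorm (d *: z) = d ^+ 2 * sqnorm z.
  by rewrite !sqnormE mulr_sumr; apply: eq_bigr => i _; rewrite mxE exprMn.
have cx : sqnorm (c *: x) = 1.
  rewrite sqZ /c exprVn sqr_sqrtr ?ltW// mulVf//.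
  by rewrite gt_eqF.
have /(sup_upper_bound (spectral_norm_has_sup M)) :
    [set eucl_norm (M *m x) | x in [set x | eucl_norm x <= 1]]
      (eucl_norm (M *m (c *: x))).
  by exists (c *: x) => //=; rewrite eucl_normE cx sqrtr1.
rewrite -/(spectral_norm M) => /le_trans/(_ Ma).
rewrite eucl_normE -scalemxAr sqZ sqrtrM ?sqr_ge0// sqrtr_sqr gtr0_norm//.
rewrite ler_pdivrMl// => h.
apply: (le_trans (key x)).
have := sqr_sqrtr (ltW x0).
move: sx h; set u := Num.sqrt _ => u0 h <-.
by rewrite expr2 mulrCA ler_pM2l// mulrC.
Qed.

Lemma bform_delta M i j :
  bform M (delta_mx i 0) (delta_mx j 0) = M i j.
Proof. by rewrite /bform trmx_delta -rowE -colE !mxE. Qed.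

(* Polarization along [e_i + e_j] and [e_i - e_j]. *)
Lemma psd_entry_le M a i j : psd M ->
  (forall x, bform M x x <= a * sqnorm x) -> `|M i j| <= a.
Proof.
move=> [sM M0] Ma.
have sq1 k : sqnorm (delta_mx k 0 : 'cV[R]_p) = 1.
  by rewrite -[LHS]mul1r -bform_scalar bform_delta mxE eqxx.
have H : sqnorm (delta_mx i 0 + delta_mx j 0 : 'cV[R]_p) +
         sqnorm (delta_mx i 0 - delta_mx j 0) = 4.
  rewrite -[X in X + _]mul1r -[X in _ + X]mul1r -!bform_scalar.
  rewrite !(bformDl, bformDr, bformNl, bformNr) !bform_delta !mxE !eqxx.
  by rewrite !mulr1n; ring.
have a1 := Ma (delta_mx i 0 + delta_mx j 0).
have a2 := Ma (delta_mx i 0 - delta_mx j 0).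
have b1 := M0 (delta_mx i 0 + delta_mx j 0).
have b2 := M0 (delta_mx i 0 - delta_mx j 0).
have n1 := sqnorm_ge0 (delta_mx i 0 + delta_mx j 0).
have n2 := sqnorm_ge0 (delta_mx i 0 - delta_mx j 0).
have a3 := Ma (delta_mx i 0); have b3 := M0 (delta_mx i 0).
rewrite -!/(bform _ _ _) ?sq1 in a1 a2 a3 b1 b2 b3.
rewrite !(bformDl, bformDr, bformNl, bformNr) !bform_delta in a1 a2 a3 b1 b2 b3.
have e : M j i = M i j by rewrite -[in LHS]sM mxE.
rewrite !e in a1 a2 b1 b2.
have a0 : 0 <= a by lra.
have c1 : a * sqnorm (delta_mx i 0 + delta_mx j 0) <= a * 4.
  by rewrite ler_wpM2l//; lra.
have c2 : a * sqnorm (delta_mx i 0 - delta_mx j 0) <= a * 4.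
  by rewrite ler_wpM2l//; lra.
by rewrite ler_norml; apply/andP; split; lra.
Qed.

End BilinearForms.

(** * Windowed integrals of a nondecreasing Lipschitz function *)

Section MonotonePrimitive.
Context {R : realType}.
Variables (f h : R -> R) (m : R).
Hypothesis hf : forall u : R, 0 <= u -> is_derive u 1 h (f u).
Hypothesis f_ndecr : forall u v : R, 0 <= u -> u <= v -> f u <= f v.
Hypothesis f_lip : forall u v : R, 0 <= u -> u <= v -> f v - f u <= m * (v - u).

Let MVT_ge0 (g dg : R -> R) (u v : R) : 0 <= u -> u <= v ->
  (forall w : R, 0 <= w -> is_derive w 1 g (dg w)) ->
  exists2 c, u <= c <= v & g v - g u = dg c * (v - u).
Proof.
move=> u0 uv gdg.
have [||c cuv ->] := @MVT_segment _ g dg u v uv.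
- by move=> w; rewrite in_itv/= => /andP[uw _]; apply: gdg; lra.
- apply: derivable_within_continuous => w; rewrite in_itv/= => /andP[uw _].
  by have [] := gdg w (le_trans u0 uw).
- by exists c => //; move: cuv; rewrite in_itv.
Qed.

Lemma primitive_bounds (u v : R) : 0 <= u -> u <= v ->
  (v - u) * f u <= h v - h u <= (v - u) * f v.
Proof.
move=> u0 uv; have [c /andP[uc cv] ->] := MVT_ge0 u0 uv hf.
rewrite (mulrC (f c)) !ler_wpM2l ?subr_ge0// f_ndecr//.
exact: le_trans uc.
Qed.

Lemma primitive_lip (u v : R) : 0 <= u -> u <= v ->
  h v - h u <= (v - u) * f u + m * (v - u) ^+ 2 / 2.
Proof.
move=> u0 uv.
(* [h] minus the parabola that bounds it: to the right of [u] the derivative of [g] is nonpositive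
   by [f_lip]. *)
pose g w := h w - (f u * w + m / 2 * (w - u) ^+ 2).
have dg (w : R) : 0 <= w -> is_derive w 1 g (f w - (f u + m * (w - u))).
  move=> w0; have dh := hf w0.
  by apply: is_derive_eq; rewrite /GRing.scale/=; field.
have [c /andP[uc cv] gE] := MVT_ge0 u0 uv dg.
have fc := f_lip u0 uc.
have : (f c - (f u + m * (c - u))) * (v - u) <= 0.
  by rewrite mulr_le0_ge0 ?subr_ge0//; lra.
by rewrite -gE /g subrr expr0n mulr0 addr0; lra.
Qed.

Variable D : R.
Hypothesis D1 : 1 <= D.

(** The integral of f w - f t for w in [t, t + D], that is, the function S of the overview seen
    along one fixed vector. *)
Definition window (t : R) := h (t + D) - h t - D * f t.

Lemma window_ge0 (t : R) : 0 <= t -> 0 <= window t.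
Proof.
move=> t0; have D1' : 1 <= D := D1; have tD : t <= t + D by lra.
by have /andP[+ _] := primitive_bounds t0 tD; rewrite /window; nra.
Qed.

Lemma window_le_increment (t : R) : 0 <= t -> window t <= D * (f (t + D) - f t).
Proof.
move=> t0; have D1' : 1 <= D := D1; have tD : t <= t + D by lra.
by have /andP[_ +] := primitive_bounds t0 tD; rewrite /window; nra.
Qed.

Lemma window_le (t : R) : 0 <= t -> window t <= m * D ^+ 2 / 2.
Proof.
move=> t0; have D1' : 1 <= D := D1; have tD : t <= t + D by lra.
have := primitive_lip t0 tD.
by rewrite /window (addrAC t) subrr add0r; lra.
Qed.

(* the integral over [t, t + 1] of the increments of [f] over windows of
   length [D] *)
Definition mean_increment (t : R) :=
  (h (t + 1 + D) - h (t + D)) - (h (t + 1) - h t).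

(** Each window [v, v + D] with v in [t, t + 1] contains [t + 1, t + D]. *)
Lemma mean_increment_ge (t : R) : 0 <= t ->
  f (t + D) - f (t + 1) <= mean_increment t.
Proof.
move=> t0; have D1' : 1 <= D := D1.
have [t1 tD tD1] : [/\ t <= t + 1, 0 <= t + D & t + D <= t + 1 + D].
  by split; lra.
have /andP[+ _] := primitive_bounds tD tD1.
have /andP[_ +] := primitive_bounds t0 t1.
by rewrite /mean_increment; nra.
Qed.

(** Split the window [t + 1, t + 1 + D] at t + D. The first piece gives at most (D - 1) (f (t + D) -
    f (t + 1)), hence D - 1 mean increments; the last unit gives at most one more, as f <= f (t + 1)
    on [t, t + 1]. *)
Lemma window_le_mean_increment (t : R) : 0 <= t ->
  window (t + 1) <= D * mean_increment t.
Proof.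
move=> t0; have D1' : 1 <= D := D1.
have [t1 t1' tD] : [/\ t <= t + 1, 0 <= t + 1 & t + 1 <= t + D].
  by split; lra.
have /andP[_ H1] := primitive_bounds t1' tD.
have /andP[_ H2] := primitive_bounds t0 t1.
have H3 := mean_increment_ge t0.
have H4 : (D - 1) * (f (t + D) - f (t + 1)) <= (D - 1) * mean_increment t.
  by rewrite ler_wpM2l//; lra.
rewrite /window.
have -> : D * mean_increment t =
  (D - 1) * mean_increment t + mean_increment t by ring.
apply: le_trans (lerD H4 (lexx _)).
by rewrite /mean_increment; lra.
Qed.

(** The jump counterpart of S' = f (t + D) - f t - D f', integrated over [t, t + 1]. *)
Lemma window_diff (t : R) :
  window t - window (t + 1) = D * (f (t + 1) - f t) - mean_increment t.
Proof. by rewrite /window /mean_increment; ring. Qed.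

End MonotonePrimitive.

(** * The bound p_M *)

Section Constants.
Context {R : realType}.
Implicit Types (u aM Delta qm qM : R).

Lemma expR_ge_quadratic u : 0 <= u -> 1 + u + u ^+ 2 / 2 <= expR u.
Proof.
move=> u0.
pose g w : R := expR w - (1 + w + w ^+ 2 / 2).
have dg (w : R) : is_derive w 1 g (expR w - (1 + w)).
  by apply: is_derive_eq; rewrite /GRing.scale/=; field.
have : g 0 <= g u.
  apply: (@ger0_derive1_ndecr _ g 0 u) => //.
  - move=> w _; rewrite derive1E; have [_ ->] := dg w.
    by rewrite subr_ge0 expR_ge1Dx.
  - by apply: derivable_within_continuous => w _; have [] := dg w.
by rewrite /g expR0; lra.
Qed.

(** The [alpha] of the overview. With D = Delta + 2 and m = aM + 1/2 the flow requires D + D^3 m aM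
    <= 2 alpha and the jumps require D + 2 D^3 m <= 2 alpha; the factor aM + 2 serves both. *)
Definition lyapunov_offset aM Delta : R :=
  ((Delta + 2) + (Delta + 2) ^+ 3 * (aM + 1 / 2) * (aM + 2)) / 2.

(** The left side is the largest value of the scalar part of P. With z = 1 / (1 - sigma), L = ln z
    and y = L / (Delta + 1), the excess of [p_M] over [qm] is qM z (1 / y + e^y / (e^y - 1)), and
    both summands in the parenthesis are at least 1 / y. *)
Lemma p_M_ge aM Delta mu0 qm qM : 0 < aM -> 0 < Delta -> 0 < mu0 ->
  sigma aM Delta mu0 < 1 -> 0 < qM ->
  qm + qM * (Delta + 1) + 2 * qM / mu0 * lyapunov_offset aM Delta
    <= p_M aM Delta mu0 qm qM.
Proof.
move=> a0 D0 mu0_gt0 sigma1 qM0.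
rewrite /p_M /lambda0 /kappa0; cbv zeta.
set s := sigma _ _ _ in sigma1 *.
pose d := Delta + 1; rewrite -/d.
have d0 : 1 < d by rewrite /d; lra.
set K := (aM + 2) * (Delta + 2) ^+ 3 * (aM * (Delta + 2) + 1 / 2).
have D3 : 8 <= (Delta + 2) ^+ 3.
  have : 4 <= (Delta + 2) ^+ 2 by nra.
  by move=> h; rewrite exprS; nra.
have K1 : (Delta + 2) ^+ 3 * (aM + 1 / 2) * (aM + 2) <= K.
  rewrite mulrAC (mulrC _ (aM + 2)) /K ler_pM2l; first by nra.
  by rewrite mulr_gt0//; lra.
have K2 : 1 <= K.
  apply: le_trans K1; nra.
pose r := 1 + Num.sqrt K.
have sqK : Num.sqrt K ^+ 2 = K by rewrite sqr_sqrtr//; lra.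
have sqK1 : 1 <= Num.sqrt K by rewrite -sqrtr1 ler_wsqrtr.
have r0 : 0 < r by rewrite /r; lra.
have sE : s = 2 * mu0 / r ^+ 2 by [].
have s0 : 0 < s by rewrite sE divr_gt0 ?exprn_gt0 ?mulr_gt0.
(* Twice the offset is at most Delta + 2 + K <= d (2 + K), and 2 + K <= r^2 because K >= 1. *)
have off : 2 / mu0 * lyapunov_offset aM Delta <= 2 * d / s.
  have -> : 2 * d / s = (d * r ^+ 2) / mu0.
    by rewrite sE; field; rewrite !gt_eqF.
  rewrite mulrAC ler_pM2r ?invr_gt0// /lyapunov_offset.
  have : 2 + K <= r ^+ 2 by rewrite /r -{1}sqK; nra.
  move=> rK; have : d * (2 + K) <= d * r ^+ 2 by rewrite ler_pM2l//; lra.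
  by apply: le_trans; rewrite /d; nra.
pose x := 1 - s; rewrite -/x.
have x0 : 0 < x by rewrite /x; lra.
have x1 : x < 1 by rewrite /x; lra.
have ix0 : 0 < 1 / x by rewrite divr_gt0.
rewrite sqr_sqrtr; last exact: ltW.
pose L := - ln x.
have L0 : 0 < L by rewrite /L oppr_gt0 ln_lt0// x0.
pose z := expR L.
have xE : x = z^-1 by rewrite /z /L expRN lnK ?invrK.
have z1 : 1 < z by rewrite /z expR_gt1.
have zq : 1 + L + L ^+ 2 / 2 <= z by apply: expR_ge_quadratic; exact: ltW.
have -> : 2 * (- ln x / (2 * d)) = L / d.
  by rewrite -/L; field; rewrite gt_eqF//; lra.
set y := L / d.
have y0 : 0 < y by rewrite divr_gt0//; lra.
have ey : 1 < expR y by rewrite expR_gt1.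
have t2 : 1 / y <= expR y / (expR y - 1).
  rewrite ler_pdivrMr// mulrAC ler_pdivlMr ?mul1r; last by rewrite subr_gt0.
  have := expR_ge1Dx (- y); rewrite expRN => h.
  have : expR y * (1 + - y) <= expR y * (expR y)^-1.
    by rewrite ler_pM2l ?expR_gt0.
  by rewrite divff ?gt_eqF ?expR_gt0//; lra.
(* As s = (z - 1) / z, this reads L (3 z - 1) <= 2 z (z - 1). It follows from the quadratic bound
   [zq]; the linear bound z >= 1 + L would be too weak. *)
have key : 2 / s + 1 <= 2 * (z / L).
  have -> : s = (z - 1) / z.
    by rewrite mulrBl mul1r divff ?gt_eqF ?expR_gt0// -xE /x; lra.
  have -> : 2 / ((z - 1) / z) + 1 = (3 * z - 1) / (z - 1).
    by field; rewrite ?subr_eq0 (gt_eqF z1) (gt_eqF (lt_trans ltr01 z1)).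
  rewrite ler_pdivrMr ?subr_gt0// mulrA mulrAC ler_pdivlMr//.
  nra.
have -> : 1 / x = z by rewrite xE div1r invrK.
rewrite -[leLHS]addrA -[leRHS]addrA lerD2l.
have -> : qM * d + 2 * qM / mu0 * lyapunov_offset aM Delta =
    qM * (d + 2 / mu0 * lyapunov_offset aM Delta) by ring.
have -> : qM * z / y + qM * z * expR y / (expR y - 1) =
    qM * (z * (1 / y) + z * (expR y / (expR y - 1))) by ring.
rewrite ler_pM2l//.
have h1 : z * (1 / y) <= z * (expR y / (expR y - 1)).
  by rewrite ler_pM2l ?expR_gt0.
have yd : z * (1 / y) = d * (z / L).
  by rewrite /y; field; rewrite ?(gt_eqF L0) ?(gt_eqF (lt_trans ltr01 d0)).
have h2 : d * (2 / s + 1) <= d * (2 * (z / L)) by rewrite ler_pM2l//; lra.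
have h3 : d * (2 / s + 1) = 2 * d / s + d by ring.
lra.
Qed.

End Constants.

(** * Lebesgue measurable functions and their primitives *)

Section LebesgueMeasurable.
Context {R : realType}.
Implicit Types (D X : set R) (f g : R -> R).

Notation mu := (@lebesgue_measure R).
Notation cmu := (@completed_lebesgue_measure R).
Notation lebT := (caratheodory_type (wlength (@idfun R))^*%mu).
Notation lmeasurable X := (measurable (X : set lebT)).

Lemma completed_algebra_genE X : completed_algebra_gen mu X = lmeasurable X.
Proof.
by rewrite -g_sigma_completed_algebra_genE completed_caratheodory_measurable.
Qed.

Lemma measurable_lmeasurable X : measurable X -> lmeasurable X.
Proof. by move=> mX; exact: (@sub_caratheodory _ _ R (wlength idfun)). Qed.

Lemma lebesgue_measurable_funP D f : lmeasurable D ->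
  lebesgue_measurable_fun D f <-> measurable_fun (D : set lebT) f.
Proof.
move=> mD; split=> [mf _ Y mY|mf Y mY]; last first.
  by rewrite completed_algebra_genE; exact: mf.
by have := mf Y mY; rewrite completed_algebra_genE.
Qed.

Lemma negligible_completed X : mu.-negligible X -> cmu.-negligible X.
Proof.
by move=> [N [mN N0 XN]]; exists N; split => //; exact: measurable_lmeasurable.
Qed.

Lemma measurable_id_completed :
  measurable_fun [set: lebT] (id : lebT -> measurableTypeR R).
Proof. by move=> _ Y mY; rewrite setTI; exact: measurable_lmeasurable. Qed.

(** The identity, measurable from the completed to the Borel sigma-algebra, pushes the completed
    measure forward to the Lebesgue measure. The change of variables is applied to positive and
    negative parts. *)
Lemma integral_completed D (g : R -> \bar R) : measurable D ->
  measurable_fun D g ->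
  (\int[cmu]_(x in D) g x = \int[mu]_(x in D) g x)%E.
Proof.
move=> mD mg.
have key (h : R -> \bar R) : measurable_fun D h -> (forall x, (0 <= h x)%E) ->
    (\int[cmu]_(x in D) h x = \int[mu]_(x in D) h x)%E.
  move=> mh h0.
  have := @ge0_integral_pushforward _ _ lebT (measurableTypeR R) R id
    measurable_id_completed cmu D h mD mh (fun y _ => h0 y).
  rewrite preimage_id => <-.
  apply: eq_measure_integral; first exact: measurable_id_completed.
  by move=> A mA _.
rewrite [LHS]integralE [RHS]integralE !key//.
- exact: measurable_funeneg.
- exact: measurable_funepos.
Qed.

Lemma Rintegral_completed D f g : measurable D ->
  lebesgue_measurable_fun D f -> measurable_fun D g ->
  {ae mu, forall x, D x -> f x = g x} ->
  \int[cmu]_(x in D) f x = \int[mu]_(x in D) g x.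
Proof.
move=> mD /lebesgue_measurable_funP => /(_ (measurable_lmeasurable mD)) mf mg fg.
rewrite /Rintegral -integral_completed//; last exact/measurable_EFinP.
congr fine; apply: (@ae_eq_integral _ lebT).
- exact: measurable_lmeasurable.
- exact/measurable_EFinP.
- apply/measurable_EFinP.
  by move=> _ Y mY; apply: measurable_lmeasurable; exact: mg.
- apply: negligible_completed; apply: negligibleS fg => x /= h1 h2.
  by apply: h1 => Dx; rewrite h2.
Qed.

(* A Lebesgue measurable function becomes Borel measurable once it is set to
   zero on a suitable null set: one that contains the negligible parts of the
   preimages of the rays []q, +oo[], [q] rational. *)
Lemma borel_modification f : lebesgue_measurable_fun setT f ->
  exists N, [/\ measurable N, mu N = 0%E &
    forall Z, measurable Z -> N `<=` Z ->
      measurable_fun setT (fun x => if x \in Z then 0 else f x)].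
Proof.
move=> mf.
have H (q : rat) : exists AN : set R * set R, [/\ measurable AN.1, measurable AN.2,
    mu AN.2 = 0%E & forall x, ~ AN.2 x -> AN.1 x <-> ratr q < f x].
  have [|A mA [N [M [mM M0 NM]] AN]] := mf `]ratr q, +oo[%classic.
    exact: measurable_itv.
  exists (A, M); split => //= x Mx.
  have : (A `|` N) x <-> (setT `&` f @^-1` `]ratr q, +oo[) x by rewrite AN.
  rewrite setTI /= in_itv/= andbT => <-; split; first by left.
  by case=> // /NM.
have [AN HAN] := choice H.
pose N := \bigcup_n (if unpickle n is Some q then (AN q).2 else set0).
have mN : measurable N.
  apply: bigcupT_measurable => n; case: unpickle => // q.
  by have [] := HAN q.
exists N; split => //.
  apply/negligibleP => //; apply: negligible_bigcup => n.
  case: unpickle => [q|]; last exact: negligible_set0.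
  by have [_ ? ? _] := HAN q; apply/negligibleP.
move=> Z mZ NZ; set g := fun x => _.
apply: (measurability _ (RGenOInfty.measurableE R)) => _ [_ [y ->] <-].
rewrite setTI.
pose F n := if unpickle n is Some q then
  if y < ratr q then (AN q).1 else set0 else set0.
have mF n : measurable (F n).
  rewrite /F; case: unpickle => // q; case: ifPn => // _.
  by have [] := HAN q.
(* Outside [Z], f x > y means that some rational q satisfies y < q < f x; on [Z] the value is 0,
   which counts exactly when y < 0. *)
have -> : g @^-1` `]y, +oo[ =
    ((\bigcup_n F n) `&` ~` Z) `|` (if y < 0 then Z else set0).
  apply/seteqP; split=> x /=; rewrite in_itv/= andbT /g.
    case: ifPn => [/set_mem Zx -> | /negP xZ yf]; first by right.
    have {}xZ : ~ Z x by move=> Zx; apply: xZ; exact: mem_set.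
    have [q] := rat_in_itvoo yf; rewrite in_itv/= => /andP[yq qf].
    left; split; last exact: xZ.
    exists (pickle q); first exact: I.
    rewrite /F pickleK yq.
    have [_ _ _ h] := HAN q; apply/h; last exact: qf.
    move=> xq; apply/xZ/NZ; exists (pickle q); first exact: I.
    by rewrite pickleK.
  case=> [[[n _] + Zx]|]; last first.
    by case: ifPn => // y0 Zx; rewrite mem_set.
  rewrite memNset// /F.
  case E : unpickle => [q|//]; case: ifPn => // yq.
  have [_ _ _ h] := HAN q; move/h => /(_ _) /(lt_trans yq); apply => xq.
  by apply/Zx/NZ; exists n => //; rewrite E.
apply: measurableU; last by case: ifP.
apply: measurableI; last exact: measurableC.
exact: bigcupT_measurable.
Qed.

#[global] Instance ae_lebesgue_filter :
  Filter (nbhs (almost_everywhere (@lebesgue_measure R))).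
Proof. exact: (ae_filter_ringOfSetsType mu). Qed.

Lemma negligible_at_most_one X : (forall x y, X x -> X y -> x = y) ->
  mu.-negligible X.
Proof.
move=> X1; have [->|/set0P[x Xx]] := eqVneq X set0.
  exact: negligible_set0.
have : mu.-negligible [set x].
  by apply/negligibleP => //; exact: lebesgue_measure_set1.
by apply: negligibleS => y Xy; exact: X1.
Qed.

End LebesgueMeasurable.

(** * Gluing densities given on a sequence of intervals *)

Section GluedDensity.
Context {R : realType} {p : nat}.
Variables (D : nat -> set R) (M : R -> nat -> 'M[R]_p).

Notation mu := (@lebesgue_measure R).
Notation lebT := (caratheodory_type (wlength (@idfun R))^*%mu).
Notation lmeasurable X := (measurable (X : set lebT)).

(** [seqDU] attributes a time shared by several intervals, such as a jump time, to the first of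
    them. The default index 0 is ruled out by the test in [glued]. *)
Definition glued_index (s : R) : nat := xget 0%N [set j | seqDU D j s].

Definition glued (s : R) : 'M[R]_p :=
  if pselect (seqDU D (glued_index s) s) then M s (glued_index s) else 0.

Lemma glued_seqDU j s : seqDU D j s -> glued s = M s j.
Proof.
move=> js; rewrite /glued; case: pselect => [is_|]; last first.
  by case; exact: (@xgetI _ 0%N [set j | seqDU D j s] j).
rewrite /=; suff -> : glued_index s = j by [].
have /trivIsetP/(_ (glued_index s) j I I) := trivIset_seqDU D.
move=> h; apply: contrapT => /eqP/h h0.
by have : (seqDU D (glued_index s) `&` seqDU D j) s by []; rewrite h0.
Qed.

Lemma glued_cases s : glued s = 0 \/ exists2 j, D j s & glued s = M s j.
Proof.
rewrite /glued; case: pselect => [h|]; last by left.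
by right; exists (glued_index s) => //; exact: subset_seqDU h.
Qed.

Lemma glued_unique j s : D j s -> (forall i, D i s -> i = j) -> glued s = M s j.
Proof.
move=> js h; have : (\bigcup_k D k) s by exists j.
by rewrite seqDU_bigcup_eq => -[i _ is_]; rewrite (glued_seqDU is_) (h i)//;
  exact: subset_seqDU is_.
Qed.

Lemma glued_eq0 s : (forall j, ~ D j s) -> glued s = 0.
Proof. by move=> h; have [//|[j /h]] := glued_cases s. Qed.

Lemma lebesgue_measurable_glued k l :
  (forall j, measurable (D j)) ->
  (forall j, lebesgue_measurable_fun (D j) (fun s => M s j k l)) ->
  lebesgue_measurable_fun setT (fun s => glued s k l).
Proof.
move=> mD mM Y mY; rewrite completed_algebra_genE.
have -> : setT `&` (fun s => glued s k l) @^-1` Y =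
    (\bigcup_j (seqDU D j `&` (D j `&` (fun s => M s j k l) @^-1` Y))) `|`
    (~` (\bigcup_j D j) `&` (if pselect (Y 0) then setT else set0)).
  apply/seteqP; split=> s.
    rewrite setTI /= => Ys.
    have [js|js] := pselect ((\bigcup_j D j) s); [left|right].
      move: (js); rewrite seqDU_bigcup_eq => -[j _ sj].
      exists j => //; split => //; split; first exact: subset_seqDU sj.
      by rewrite /= -(glued_seqDU sj).
    split=> //; case: pselect => // -[].
    move: Ys; rewrite glued_eq0 ?mxE// => j jsj; apply: js; by exists j.
  case=> [[j _ [sj [_ /=]]]|[js]].
    by rewrite -(glued_seqDU sj); split.
  case: pselect => // Y0 _; split=> //=.
  by rewrite glued_eq0 ?mxE// => j jsj; apply: js; exists j.
apply: (@measurableU _ lebT).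
  apply: (@bigcupT_measurable _ lebT) => j; apply: (@measurableI _ lebT).
    by apply: measurable_lmeasurable; exact: seqDU_measurable.
  by rewrite -completed_algebra_genE; exact: mM.
apply: measurable_lmeasurable; apply: measurableI; last first.
  by case: pselect => _ /=; [exact: measurableT|exact: measurable0].
by apply: measurableC; exact: bigcupT_measurable.
Qed.

End GluedDensity.

(** * Primitive of a bounded Borel density of semidefinite matrices *)

Section PrimitiveOfDensity.
Context {R : realType} {p : nat}.
Variables (G : R -> 'M[R]_p) (m : R).
Notation mu := (@lebesgue_measure R).
Hypothesis mG : forall k l, measurable_fun setT (fun s => G s k l).
Hypothesis G_psd : forall s, psd (G s).
Hypothesis G_le : forall s x, bform (G s) x x <= m * sqnorm x.

Lemma density_integrable (X : set R) k l : measurable X -> (mu X < +oo)%E ->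
  mu.-integrable X (EFin \o (fun s => G s k l)).
Proof.
move=> mX Xfin; apply: measurable_bounded_integrable => //.
  exact: measurable_funS (mG k l).
exists m; split; first exact: num_real.
move=> y my s _ /=.
by rewrite (le_trans (psd_entry_le _ _ (G_psd s) (G_le s)))// ltW.
Qed.

Definition density_primitive (y : R) : 'M[R]_p :=
  \matrix_(k, l) \int[mu]_(s in `[0, y]) G s k l.

Let itv_fin (i : interval R) a b : (forall x, x \in i -> a <= x <= b) ->
  (mu [set` i] < +oo)%E.
Proof.
move=> iab; apply: (@le_lt_trans _ _ (mu `[a, b])).
  by apply: le_measure; rewrite ?inE//= => x xi; rewrite /= in_itv/=; exact: iab.
by rewrite /= lebesgue_measure_itv/=; case: ifP => // _; rewrite -EFinB ltry.
Qed.

Lemma density_primitiveB u v : 0 <= u -> u <= v ->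
  density_primitive v - density_primitive u =
  \matrix_(k, l) \int[mu]_(s in `]u, v]) G s k l.
Proof.
move=> u0 uv; apply/matrixP => k l; rewrite !mxE.
apply: Rintegral_itvB; rewrite ?bnd_simp//.
apply: density_integrable => //.
by apply: (@itv_fin _ 0 v) => x; rewrite in_itv.
Qed.

Lemma integrable_sumR (X : set R) (I : Type) (r : seq I) (f : I -> R -> R) :
  measurable X -> (forall i, mu.-integrable X (EFin \o f i)) ->
  mu.-integrable X (EFin \o (fun s => \sum_(i <- r) f i s)).
Proof.
move=> mX fi.
have -> : EFin \o (fun s => \sum_(i <- r) f i s) =
    (fun s => \sum_(i <- r) ((EFin \o f i) s))%E.
  by apply/funext => s /=; rewrite sumEFin.
by apply: integrable_sum.
Qed.

Lemma Rintegral_sum (X : set R) (I : Type) (r : seq I) (f : I -> R -> R) :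
  measurable X -> (forall i, mu.-integrable X (EFin \o f i)) ->
  \int[mu]_(s in X) (\sum_(i <- r) f i s) = \sum_(i <- r) \int[mu]_(s in X) f i s.
Proof.
move=> mX fi; elim: r => [|i r ih].
  under eq_Rintegral do rewrite big_nil.
  by rewrite big_nil Rintegral_cst// mul0r.
under eq_Rintegral do rewrite big_cons.
by rewrite big_cons RintegralD// ?ih//; exact: integrable_sumR.
Qed.

Lemma bform_Rintegral (X : set R) x : measurable X -> (mu X < +oo)%E ->
  bform (\matrix_(k, l) \int[mu]_(s in X) G s k l) x x =
  \int[mu]_(s in X) bform (G s) x x /\
  mu.-integrable X (EFin \o (fun s => bform (G s) x x)).
Proof.
move=> mX Xfin.
have iG k l : mu.-integrable X (EFin \o (fun s => x k 0 * x l 0 * G s k l)).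
  have := @integrableZl _ _ R mu X mX (x k 0 * x l 0) _
    (density_integrable k l mX Xfin).
  by apply: eq_integrable => // s _; rewrite /= EFinM.
have isum k : mu.-integrable X (EFin \o (fun s => \sum_l x k 0 * x l 0 * G s k l)).
  exact: integrable_sumR.
have -> : (fun s => bform (G s) x x) =
    (fun s => \sum_k \sum_l x k 0 * x l 0 * G s k l).
  by apply/funext => s; rewrite bform_entries.
split; last exact: integrable_sumR.
rewrite bform_entries Rintegral_sum//; apply: eq_bigr => k _.
rewrite Rintegral_sum//; apply: eq_bigr => l _.
by rewrite RintegralZl ?mxE//; exact: density_integrable.
Qed.

Lemma density_primitive_psd u v : 0 <= u -> u <= v ->
  psd (density_primitive v - density_primitive u).
Proof.
move=> u0 uv; rewrite density_primitiveB//; split.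
  apply/matrixP => k l; rewrite !mxE; apply: eq_Rintegral => s _.
  by have [sG _] := G_psd s; rewrite -[in RHS]sG mxE.
move=> x; rewrite -/(bform _ _ _).
have [||-> _] := @bform_Rintegral `]u, v] x.
- exact: measurable_itv.
- by apply: (@itv_fin _ u v) => y; rewrite in_itv/= => /andP[/ltW -> ->].
- by apply: Rintegral_ge0 => s _; have [_] := G_psd s; apply.
Qed.

Lemma density_primitive_le u v x : 0 <= u -> u <= v ->
  bform (density_primitive v - density_primitive u) x x <=
  m * (v - u) * sqnorm x.
Proof.
move=> u0 uv; rewrite density_primitiveB//.
have fin : (mu `]u, v] < +oo)%E.
  by apply: (@itv_fin _ u v) => y; rewrite in_itv/= => /andP[/ltW -> ->].
have [-> iG] := @bform_Rintegral `]u, v] x (measurable_itv _) fin.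
have : \int[mu]_(s in `]u, v]) bform (G s) x x <=
       \int[mu]_(s in `]u, v]) (m * sqnorm x).
  apply: le_Rintegral => //.
  apply: measurable_bounded_integrable => //.
  exists `|m * sqnorm x|; split; first exact: num_real.
  by move=> y my s _ /=; exact: ltW.
rewrite Rintegral_cst//= lebesgue_measure_itv/= lte_fin.
by move: uv; rewrite le_eqVlt => /predU1P[->|->]; rewrite ?ltxx/= ?subrr; lra.
Qed.

Lemma density_primitive_derive : {ae mu, forall t : R, 0 < t -> forall k l,
  is_derive t 1 (fun s => density_primitive s k l) (G t k l)}.
Proof.
have H k l : {ae mu, forall t : R, 0 < t ->
    is_derive t 1 (fun s => density_primitive s k l) (G t k l)}.
  have i1 y : mu.-integrable `[0, y] (EFin \o (fun s => G s k l)).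
    apply: density_integrable => //.
    by apply: (@itv_fin _ 0 y) => x; rewrite in_itv.
  have i2 : locally_integrable setT (fun s => G s k l).
    split; [exact: mG|exact: openT|move=> K _ cK].
    have mK : measurable K by exact: compact_measurable.
    have := density_integrable k l mK (compact_finite_measure cK).
    by move=> /integrableP[].
  have := @FTC1 R (fun s => G s k l) (BLeft 0) i1 i2.
  apply: filterS => t h t0.
  have [|dt t1] := h; first by rewrite lte_fin.
  have -> : (fun s => density_primitive s k l) =
      (fun x => \int[mu]_(t in `[0, x]) G t k l).
    by apply/funext => s; rewrite mxE.
  by apply: DeriveDef => //; rewrite -derive1E.
have : {ae mu, forall t : R, forall kl : 'I_p * 'I_p, 0 < t ->
    is_derive t 1 (fun s => density_primitive s kl.1 kl.2) (G t kl.1 kl.2)}.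
  apply: filter_forall => kl; exact: H.
by apply: filterS => t h t0 k l; exact: (h (k, l)).
Qed.

End PrimitiveOfDensity.

(** * Primitive of the glued density *)

Section GluedPrimitive.
Context {R : realType} {p : nat}.
Variables (D : nat -> set R) (M : R -> nat -> 'M[R]_p) (m : R).
Notation mu := (@lebesgue_measure R).

Hypothesis m_ge0 : 0 <= m.
Hypothesis D_ge0 : forall j s, D j s -> 0 <= s.
Hypothesis D_itv : forall j, is_interval (D j).
Hypothesis D_sorted : forall i j s t, (i < j)%N -> D i s -> D j t -> s <= t.
Hypothesis M_meas : forall j k l, lebesgue_measurable_fun (D j) (fun s => M s j k l).
Hypothesis M_psd : forall j, {ae mu, forall s, D j s ->
  psd (M s j) /\ forall x, bform (M s j) x x <= m * sqnorm x}.

(** Two sorted intervals share at most one point, and there are countably many of them. *)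
Lemma ae_glued j : {ae mu, forall s, D j s -> glued D M s = M s j}.
Proof.
have : {ae mu, forall s, forall i, i != j -> ~ (D i s /\ D j s)}.
  apply: ae_foralln => i; have [ij|ij] := eqVneq i j.
    exact: aeW.
  have : mu.-negligible [set s | D i s /\ D j s].
    apply: negligible_at_most_one => s t [is_ js] [it jt].
    apply/eqP; rewrite eq_le.
    have [lij|lji|eij] := ltngtP i j; last by rewrite eij eqxx in ij.
      by rewrite (D_sorted lij is_ jt) (D_sorted lij it js).
    by rewrite (D_sorted lji js it) (D_sorted lji jt is_).
  by apply: negligibleS => s /=; apply: contra_notP => h _.
apply: filterS => s h js; apply: glued_unique => // i is_.
by apply/eqP/negPn/negP => ij; exact: (h i ij).
Qed.

Lemma glued_borel : exists G : R -> 'M[R]_p,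
  [/\ forall k l, measurable_fun setT (fun s => G s k l),
      forall s, psd (G s),
      forall s x, bform (G s) x x <= m * sqnorm x
    & {ae mu, forall s, G s = glued D M s}].
Proof.
have mD j : measurable (D j) by exact: is_interval_measurable.
have H (kl : 'I_p * 'I_p) := borel_modification
  (lebesgue_measurable_glued mD (fun j => M_meas j kl.1 kl.2)).
have [N HN] := choice H.
have aeN : {ae mu, forall s, forall kl, ~ N kl s}.
  apply: filter_forall => kl; have [mN N0 _] := HN kl.
  by exists (N kl); split => // s /=; exact: contrapT.
(* A single null set [Z] repairs the measurability of all entries and also removes the times at
   which positivity or the bound on [M] fails. *)
have [Z [mZ Z0 HZ]] := filterI (ae_foralln M_psd) aeN.
have Zn : mu.-negligible Z by apply/negligibleP.
have good s : ~ Z s -> psd (glued D M s) /\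
    forall x, bform (glued D M s) x x <= m * sqnorm x.
  move=> Zs; have [->|[j js ->]] := glued_cases D M s.
    split; first split; first by rewrite trmx0.
      by move=> x; rewrite mulmx0 mul0mx mxE.
    by move=> x; rewrite /bform mulmx0 mul0mx mxE mulr_ge0// sqnorm_ge0.
  apply: contrapT => h; apply: Zs; apply: HZ => /= -[h' _].
  exact/h/h'.
exists (fun s => if s \in Z then 0 else glued D M s); split.
- move=> k l; have [_ _ /(_ Z mZ)] := HN (k, l).
  have NZ : N (k, l) `<=` Z.
    by move=> s Ns; apply: HZ => /= -[_] /(_ (k, l)).
  move=> /(_ NZ); congr measurable_fun; apply/funext => s /=.
  by case: ifP => //; rewrite mxE.
- move=> s; case: ifPn => [_|/negP Zs].
    split; first by rewrite trmx0.
    by move=> x; rewrite mulmx0 mul0mx mxE.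
  by apply: (good s _).1 => zs; apply: Zs; exact: mem_set.
- move=> s x; case: ifPn => [_|/negP Zs].
    by rewrite /bform mulmx0 mul0mx mxE mulr_ge0// sqnorm_ge0.
  by apply: (good s _).2 => zs; apply: Zs; exact: mem_set.
- apply: negligibleS Zn => s /= h; apply: contrapT => Zs.
  by apply: h; rewrite memNset.
Qed.

(** Used twice: for [A] on the flow intervals, and for the jumps on unit intervals. *)
Lemma glued_primitive : exists F : R -> 'M[R]_p,
  [/\ forall u v, 0 <= u -> u <= v -> psd (F v - F u),
      forall u v x, 0 <= u -> u <= v ->
        bform (F v - F u) x x <= m * (v - u) * sqnorm x,
      forall j u v, u <= v -> D j u -> D j v ->
        F v - F u = mx_integral [set s | u <= s <= v] (fun s => M s j)
    & forall j, {ae mu, forall t : R, D j t -> forall k l,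
        is_derive t 1 (fun s => F s k l) (M t j k l)}].
Proof.
have [G [mG G_psd G_le GM]] := glued_borel.
exists (density_primitive G); split.
- by move=> u v u0 uv; exact: (density_primitive_psd mG G_psd G_le).
- by move=> u v x u0 uv; exact: (density_primitive_le mG G_psd G_le).
- move=> j u v uv ju jv; have u0 := D_ge0 ju.
  rewrite (density_primitiveB mG G_psd G_le)//.
  apply/matrixP => k l; rewrite !mxE.
  have uvE : [set s | u <= s <= v] = `[u, v]%classic.
    by apply/seteqP; split => s /=; rewrite in_itv.
  rewrite Rintegral_itv_obnd_cbnd; last first.
    apply: (density_integrable mG G_psd G_le) => //.
    by rewrite lebesgue_measure_itv/=; case: ifP => // _; rewrite -EFinB ltry.
  rewrite uvE; apply/esym; apply: Rintegral_completed => //.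
  + move=> Y mY.
    have sub : `[u, v] `<=` D j.
      by move=> s /=; rewrite in_itv/= => /D_itv; exact.
    have -> : `[u, v] `&` (fun s => M s j k l) @^-1` Y =
        `[u, v] `&` (D j `&` (fun s => M s j k l) @^-1` Y).
      by rewrite setIA (setIidl sub).
    rewrite completed_algebra_genE; apply: measurableI.
      exact: measurable_lmeasurable.
    by rewrite -completed_algebra_genE; exact: M_meas.
  + exact: measurable_funS (mG k l).
  + have := ae_glued j; move: GM; apply: filterS2 => s -> h.
    rewrite /= in_itv/= => sv; rewrite h//.
    exact: D_itv ju jv _ sv.
- move=> j; have dF := density_primitive_derive mG G_psd G_le.
  (* The integral defining the primitive starts at 0, so its derivative is available only at
     positive times. *)
  have n0 : {ae mu, forall t : R, t != 0}.
    have : mu.-negligible [set (0 : R)].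
      by apply/negligibleP => //; exact: lebesgue_measure_set1.
    apply: negligibleS => t /= h; apply: contrapT => t0; apply: h.
    exact/eqP.
  move: n0 dF; apply: filter_app2; move: GM (ae_glued j).
  apply: filterS2 => t Gt Mt t0 dt jt k l.
  by rewrite -Mt// -Gt; apply: dt; rewrite lt_def t0 (D_ge0 jt).
Qed.

End GluedPrimitive.

(** * Hybrid time domains *)

Section HybridTimes.
Context {R : realType}.
Variables (E : set (R * nat)) (t_ : nat -> \bar R).
Hypothesis hE : hybrid_time_domain E.
Hypothesis ht : jump_times E t_.

Lemma hybrid_time_ge0 t j : E (t, j) -> 0 <= t.
Proof. by case: hE => h _; exact: h. Qed.

Lemma jump_times_bounds t j : E (t, j) -> (t_ j <= t%:E <= t_ j.+1)%E.
Proof.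
move=> tj; have [_ _ /(_ _ _ tj) h _] := ht.
have : (E `&` ([set s | 0 <= s <= t] `*` [set i | (i <= j)%N])) (t, j).
  by split => //; split => //=; rewrite (hybrid_time_ge0 tj) lexx.
rewrite h => -[i _ [/= /andP[h1 h2] ->]]; rewrite h1/=.
by move: h2; rewrite le_min => /andP[].
Qed.

Lemma jump_times_mem T J s j : E (T, J) -> (j <= J)%N ->
  (t_ j <= s%:E)%E -> (s%:E <= t_ j.+1)%E -> s <= T -> E (s, j).
Proof.
move=> TJ jJ h1 h2 sT; have [_ _ /(_ _ _ TJ) h _] := ht.
suff : (E `&` ([set s | 0 <= s <= T] `*` [set i | (i <= J)%N])) (s, j) by case.
by rewrite h; exists j => //; split => //=; rewrite h1/= le_min lee_fin sT.
Qed.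

Lemma jump_times_le T J i j : E (T, J) -> (i <= j)%N -> (j <= J.+1)%N ->
  (t_ i <= t_ j)%E.
Proof.
move=> TJ ij; elim: j ij => [|j ih]; first by rewrite leqn0 => /eqP ->.
rewrite leq_eqVlt => /predU1P[->//|]; rewrite ltnS => ij jJ.
apply: (le_trans (ih ij (ltnW jJ))).
have [_ + _ _] := ht; apply.
apply: (@le_trans _ _ (J%:R)%:E); first by rewrite lee_fin ler_nat.
by apply: ereal_sup_ubound; exists (T, J).
Qed.

Lemma jump_times_ge0 T J j : E (T, J) -> (j <= J.+1)%N -> (0 <= t_ j)%E.
Proof. by have [<- _ _ _] := ht => TJ; exact: (jump_times_le TJ). Qed.

Lemma hybrid_time_sorted i j s t : (i < j)%N -> E (s, i) -> E (t, j) -> s <= t.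
Proof.
move=> ij si tj; rewrite -lee_fin.
have /andP[_ h1] := jump_times_bounds si.
have /andP[h2 _] := jump_times_bounds tj.
by rewrite (le_trans h1)// (le_trans _ h2)// (jump_times_le tj)// ltnW.
Qed.

Lemma flow_interval_is_interval j : is_interval (flow_interval E j).
Proof.
move=> s t sj tj u /andP[su ut].
have /andP[h1 _] := jump_times_bounds sj.
have /andP[_ h2] := jump_times_bounds tj.
apply: (jump_times_mem tj) => //.
  by rewrite (le_trans h1)// lee_fin.
by rewrite (le_trans _ h2)// lee_fin.
Qed.

Lemma hybrid_time_origin x : E x -> E (0, 0%N).
Proof.
case: x => T J TJ; have t0 : t_ 0%N = 0%E by case: ht.
apply: (jump_times_mem TJ) => //; rewrite ?t0 ?(jump_times_ge0 TJ)//.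
exact: hybrid_time_ge0 TJ.
Qed.

Lemma jump_time_mem T J i : E (T, J) -> (i < J)%N ->
  [/\ (fine (t_ i.+1))%:E = t_ i.+1, E (fine (t_ i.+1), i)
    & E (fine (t_ i.+1), i.+1)].
Proof.
move=> TJ iJ; have /andP[hT _] := jump_times_bounds TJ.
have h1 : (t_ i.+1 <= T%:E)%E by rewrite (le_trans _ hT)// (jump_times_le TJ).
have h0 : (0 <= t_ i.+1)%E by rewrite (jump_times_ge0 TJ)// ltnW// ltnS ltnW.
have fE : (fine (t_ i.+1))%:E = t_ i.+1.
  by rewrite fineK// ge0_fin_numE// (le_lt_trans h1)// ltry.
split=> //; apply: (jump_times_mem TJ); rewrite ?fE// -?lee_fin ?fE//.
- exact: ltnW.
- by rewrite (jump_times_le TJ)// ltnW.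
- by rewrite (jump_times_le TJ).
Qed.

Lemma jump_set_time t j : jump_set E (t, j) -> t_ j.+1 = t%:E.
Proof.
move=> [/= tj tj1]; apply/eqP; rewrite eq_le.
have /andP[_ ->] := jump_times_bounds tj.
by have /andP[-> _] := jump_times_bounds tj1.
Qed.

(** Take the least jump count [j] with a point of total time at least [v]. Either [v] falls in the
    flow interval of index [j], or it lies in the gap of length 1 just before it and the landing
    point of the jump will do. *)
Lemma hybrid_time_next v T J : E (T, J) -> 0 <= v -> v <= T + J%:R ->
  exists t j, E (t, j) /\ v <= t + j%:R < v + 1.
Proof.
move=> TJ v0 vT.
pose P j := `[< exists s, E (s, j) /\ v <= s + j%:R >].
have exP : exists j, P j by exists J; apply/asboolP; exists T.
case: (ex_minnP exP) => -[|i] /asboolP[s [sE vs]] minP.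
  exists v, 0%N; rewrite addr0; split; last lra.
  apply: (flow_interval_is_interval (hybrid_time_origin TJ) sE).
  by rewrite v0/=; rewrite addr0 in vs.
have [eE ei ei1] := jump_time_mem sE (ltnSn i).
set e := fine _ in eE ei ei1.
have ev : e + i%:R < v.
  rewrite ltNge; apply/negP => h; have := minP i; rewrite ltnn => /implyP.
  by rewrite implybF => /negP; apply; apply/asboolP; exists e.
have [ve|ve] := leP v (e + i.+1%:R).
  by exists e, i.+1; split=> //; rewrite ve/= -natr1; lra.
exists (v - i.+1%:R), i.+1; split; last by rewrite subrK lexx/=; lra.
by apply: (flow_interval_is_interval ei1 sE); apply/andP; split; lra.
Qed.

Section Excitation.
Context {p : nat}.

Lemma sum_mx_integral (A : R -> nat -> 'M[R]_p) (F : R -> 'M[R]_p) t1 j1 t2 j2 :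
  (forall j u v, u <= v -> E (u, j) -> E (v, j) ->
     F v - F u = mx_integral [set s | u <= s <= v] (fun s => A s j)) ->
  E (t1, j1) -> E (t2, j2) -> (j1 <= j2)%N -> t1 <= t2 ->
  \sum_(j1 <= j < j2.+1)
    mx_integral [set s | (maxe t1%:E (t_ j) <= s%:E <= mine t2%:E (t_ j.+1))%E]
      (fun s => A s j) = F t2 - F t1.
Proof.
move=> FA E1 E2 j12 t12.
(* The [j]-th integral runs from [e j] to [e j.+1], so the sum telescopes. *)
pose e j := if (j <= j1)%N then t1 else if (j <= j2)%N then fine (t_ j) else t2.
have e1 : e j1 = t1 by rewrite /e leqnn.
have e2 : e j2.+1 = t2 by rewrite /e leqNgt ltnS j12/= ltnn.
have /andP[b1 b1'] := jump_times_bounds E1.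
have /andP[b2 b2'] := jump_times_bounds E2.
have -> : F t2 - F t1 = F (e j2.+1) - F (e j1) by rewrite e1 e2.
rewrite -(telescope_sumr (fun j => F (e j)) (leqW j12)).
apply: eq_big_nat => j /andP[j1j]; rewrite ltnS => jj2.
have [E1j lo] : E (e j, j) /\ maxe t1%:E (t_ j) = (e j)%:E.
  move: j1j; rewrite leq_eqVlt => /predU1P[<-|j1j].
    by rewrite e1; split => //; apply/max_idPl.
  case: j j1j jj2 => // i j1i ij2.
  have [eE _ ei1] := jump_time_mem E2 ij2.
  rewrite /e leqNgt j1i/= ij2; split => //; rewrite eE; apply/max_idPr.
  by rewrite (le_trans b1')// (jump_times_le E2)// ltnW.
have [E2j hi] : E (e j.+1, j) /\ mine t2%:E (t_ j.+1) = (e j.+1)%:E.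
  move: (jj2); rewrite leq_eqVlt => /predU1P[->|j2j].
    by rewrite e2; split => //; apply/min_idPl.
  have [eE ei _] := jump_time_mem E2 j2j.
  rewrite /e leqNgt ltnS j1j/= j2j; split => //; rewrite eE; apply/min_idPr.
  by rewrite (le_trans _ b2)// (jump_times_le E2).
rewrite lo hi (FA j)//.
rewrite -lee_fin -lo -hi ge_max !le_min lee_fin t12/=.
rewrite (le_trans b1'); last by rewrite (jump_times_le E2)// ?ltnS.
rewrite (le_trans _ b2); last by rewrite (jump_times_le E2)// ltnW.
by rewrite (jump_times_le E2)//.
Qed.

Lemma sum_increments (B : nat -> 'M[R]_p) (F : R -> 'M[R]_p) j1 j2 :
  (j1 <= j2)%N -> (forall j, F j.+1%:R - F j%:R = B j) ->
  \sum_(j1 <= j < j2) B j = F j2%:R - F j1%:R.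
Proof.
move=> j12 FB; rewrite -(telescope_sumr (fun j => F j%:R) j12).
by apply: eq_big_nat => j _.
Qed.

End Excitation.

(* The [t]-component of the hybrid time whose total time [t + j] is [v]: the
   supremum extends it from the total times of [E] to the real line as a
   nondecreasing 1-Lipschitz function. *)
Definition clock (v : R) : R := sup [set Num.min x.1 (v - x.2%:R) | x in E].

Lemma clock_has_sup v : E !=set0 -> has_sup [set Num.min x.1 (v - x.2%:R) | x in E].
Proof.
move=> [x Ex]; split; first by exists (Num.min x.1 (v - x.2%:R)); exists x.
exists v => _ [y Ey <-]; rewrite ge_min; apply/orP; right.
by rewrite gerBl ler0n.
Qed.

Lemma clock_ub v x : E x -> Num.min x.1 (v - x.2%:R) <= clock v.
Proof.
move=> Ex; apply: sup_upper_bound; last by exists x.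
by apply: clock_has_sup; exists x.
Qed.

Lemma clock_le v w : E !=set0 -> (forall x, E x -> Num.min x.1 (v - x.2%:R) <= w) ->
  clock v <= w.
Proof.
move=> /(clock_has_sup v)[ne _] h; apply: ge_sup => // _ [x Ex <-].
exact: h.
Qed.

Lemma clock_ndecr u v : E !=set0 -> u <= v -> clock u <= clock v.
Proof.
move=> E0 uv; apply: clock_le => // x Ex; apply: le_trans (clock_ub v Ex).
by rewrite le_min !ge_min lexx/= lerD2r uv orbT.
Qed.

(** This form of the Lipschitz property says that the interpolated jump count v - clock v is
    nondecreasing. *)
Lemma clock_lip u v : E !=set0 -> u <= v -> u - clock u <= v - clock v.
Proof.
move=> E0 uv; rewrite -subr_ge0; have : clock v <= clock u + (v - u).
  apply: clock_le => // x Ex.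
  have := clock_ub u Ex; rewrite /Num.min; do 2 case: ifPn; rewrite -?leNgt; lra.
lra.
Qed.

(** A point (s, i) with i < j has s <= t by ordering; one with i >= j contributes at most t + j - i
    <= t. *)
Lemma clock_hybrid t j : E (t, j) -> clock (t + j%:R) = t.
Proof.
move=> tj; have E0 : E !=set0 by exists (t, j).
apply/eqP; rewrite eq_le; apply/andP; split; last first.
  by have := clock_ub (t + j%:R) tj; rewrite /= addrK minxx.
apply: clock_le => // -[s i] si /=; rewrite ge_min.
have [ij|ij] := ltnP i j; first by rewrite (hybrid_time_sorted ij si tj).
apply/orP; right; have : j%:R <= i%:R :> R by rewrite ler_nat.
lra.
Qed.

Lemma clock0 : E !=set0 -> clock 0 = 0.
Proof.
by move=> [x /hybrid_time_origin/clock_hybrid]; rewrite addr0.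
Qed.

End HybridTimes.

(** * The cumulative excitation *)

Lemma mx_integral_cst (R : realType) (p : nat) (u v : R) (C : 'M[R]_p) : u <= v ->
  mx_integral [set s | u <= s <= v] (fun _ => C) = (v - u) *: C.
Proof.
move=> uv; apply/matrixP => k l; rewrite !mxE.
have -> : [set s | u <= s <= v] = `[u, v]%classic.
  by apply/seteqP; split => s /=; rewrite in_itv.
rewrite (@Rintegral_completed _ _ (cst (C k l)) (cst (C k l))).
- rewrite Rintegral_cst//.
  have -> : fine (lebesgue_measure `[u, v]%classic) = v - u.
    rewrite lebesgue_measure_itv/= lte_fin.
    by move: uv; rewrite le_eqVlt => /predU1P[->|->]; rewrite ?ltxx/= ?subrr.
  by rewrite mulrC.
- exact: measurable_itv.
- apply/lebesgue_measurable_funP; last exact: measurable_cst.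
  by apply: measurable_lmeasurable.
- exact: measurable_cst.
- exact: aeW.
Qed.

(** Only a least and a greatest element can fail to be interior. Derivatives along [I^j] are taken
    at interior times, as [F] has its hybrid form only on [E]. *)
Lemma ae_interior (R : realType) (I : set R) : is_interval I ->
  {ae (@lebesgue_measure R), forall t, I t -> nbhs t I}.
Proof.
move=> itvI.
have lo : (@lebesgue_measure R).-negligible [set t | I t /\ forall s, I s -> t <= s].
  apply: negligible_at_most_one => s t [sI hs] [tI ht].
  by apply/eqP; rewrite eq_le hs ?ht.
have hi : (@lebesgue_measure R).-negligible [set t | I t /\ forall s, I s -> s <= t].
  apply: negligible_at_most_one => s t [sI hs] [tI ht].
  by apply/eqP; rewrite eq_le hs ?ht.
have := negligibleU lo hi; apply: negligibleS => t /= h.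
apply: contrapT => /not_orP[h1 h2]; apply: h => tI.
have [s sI st] : exists2 s, I s & s < t.
  apply: contrapT => h; apply: h1; split => // s sI.
  by rewrite leNgt; apply/negP => st; apply: h; exists s.
have [u uI tu] : exists2 u, I u & t < u.
  apply: contrapT => h; apply: h2; split => // u uI.
  by rewrite leNgt; apply/negP => ut; apply: h; exists u.
have : nbhs t `]s, u[%classic by apply: near_in_itvoo; rewrite in_itv/= st tu.
apply: filterS => v /=; rewrite in_itv/= => /andP[sv vu].
by apply: (itvI s u sI uI); rewrite !ltW.
Qed.

Section Cumulative.
Context {R : realType} {p : nat}.
Variables (E : set (R * nat)) (t_ : nat -> \bar R) (A B : R -> nat -> 'M[R]_p).
Variables (aM Delta mu0 : R).
Notation mu := (@lebesgue_measure R).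
Hypothesis hE : hybrid_time_domain E.
Hypothesis ht : jump_times E t_.
Hypothesis hAmeas : forall j k l,
  lebesgue_measurable_fun (flow_interval E j) (fun t => A t j k l).
Hypothesis aM_ge0 : 0 <= aM.
Hypothesis hA : forall j, {ae mu, forall t, flow_interval E j t ->
  psd (A t j) /\ forall x, bform (A t j) x x <= aM * sqnorm x}.
Hypothesis hB : forall t j, jump_set E (t, j) ->
  psd (B t j) /\ forall x, bform (B t j) x x <= sqnorm x.
Hypothesis hDelta : 0 < Delta.
Hypothesis hPE : persistently_exciting E t_ A B Delta mu0.
Hypothesis E0 : E !=set0.

(** Extension by 0 when there is no jump of index [j], so that every unit interval carries a
    semidefinite density bounded by 1. *)
Let Bj j : 'M[R]_p :=
  if pselect (jump_set E (fine (t_ j.+1), j)) then B (fine (t_ j.+1)) j else 0.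

Let Bj_jump t j : jump_set E (t, j) -> Bj j = B t j.
Proof.
move=> tj; have := jump_set_time hE ht tj; rewrite /Bj => ->.
by case: pselect.
Qed.

Let Bj_psd j : psd (Bj j) /\ forall x, bform (Bj j) x x <= 1 * sqnorm x.
Proof.
rewrite /Bj; case: pselect => [h|_] /=.
  by have [h1 h2] := hB h; split => // x; rewrite mul1r.
split; first split; first by rewrite trmx0.
  by move=> x; rewrite mulmx0 mul0mx mxE.
by move=> x; rewrite /bform mulmx0 mul0mx mxE mul1r sqnorm_ge0.
Qed.

Lemma flow_primitive : exists F : R -> 'M[R]_p,
  [/\ forall u v, 0 <= u -> u <= v -> psd (F v - F u),
      forall u v x, 0 <= u -> u <= v ->
        bform (F v - F u) x x <= aM * (v - u) * sqnorm x,
      forall j u v, u <= v -> E (u, j) -> E (v, j) ->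
        F v - F u = mx_integral [set s | u <= s <= v] (fun s => A s j)
    & forall j, {ae mu, forall t : R, flow_interval E j t -> forall k l,
        is_derive t 1 (fun s => F s k l) (A t j k l)}].
Proof.
apply: (@glued_primitive _ _ (flow_interval E) A aM) => //.
- by move=> j s; exact: hybrid_time_ge0.
- exact: (flow_interval_is_interval hE ht).
- by move=> i j s t; exact: (hybrid_time_sorted hE ht).
Qed.

Lemma jump_primitive : exists F : R -> 'M[R]_p,
  [/\ forall u v, 0 <= u -> u <= v -> psd (F v - F u),
      forall u v x, 0 <= u -> u <= v ->
        bform (F v - F u) x x <= 1 * (v - u) * sqnorm x
    & forall j, F j.+1%:R - F j%:R = Bj j].
Proof.
have [||||||F [F1 F2 F3 _]] := @glued_primitive R p
  (fun j => `[j%:R, j.+1%:R]%classic) (fun _ j => Bj j) 1.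
- by [].
- by move=> j s /=; rewrite in_itv/= => /andP[js _]; exact: le_trans js.
- by move=> j; exact: interval_is_interval.
- move=> i j s t ij /=; rewrite !in_itv/= => /andP[_ si] /andP[jt _].
  by rewrite (le_trans si)// (le_trans _ jt)// ler_nat.
- move=> j k l; apply/lebesgue_measurable_funP; last exact: measurable_cst.
  by apply: measurable_lmeasurable.
- by move=> j; apply: aeW => s _; exact: Bj_psd.
exists F; split => // j.
have jj : j%:R <= j.+1%:R :> R by rewrite ler_nat.
rewrite (F3 j) ?/= ?in_itv/= ?lexx ?jj// mx_integral_cst//.
by rewrite -natrB// subSnn scale1r.
Qed.

(** The primitive of [A] is evaluated at the clock and half the primitive of the jumps at the
    interpolated jump count. Both arguments are nondecreasing and their sum is 1-Lipschitz, whence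
    the constant [aM + 1 / 2]. *)
Lemma cumulative_excitation : exists F : R -> 'M[R]_p,
  (forall v, (F v)^T = F v) /\
  [/\ forall u v, u <= v -> psd (F v - F u),
      forall u v x, u <= v ->
        bform (F v - F u) x x <= (aM + 1 / 2) * (v - u) * sqnorm x,
      forall j, {ae mu, forall t : R, flow_interval E j t -> forall k l,
        is_derive t 1 (fun s => F (s + j%:R) k l) (A t j k l)},
      forall t j, jump_set E (t, j) ->
        F (t + j.+1%:R) - F (t + j%:R) = 2^-1 *: B t j
    & forall t1 j1 t2 j2 x, E (t1, j1) -> E (t2, j2) ->
        t1 + j1%:R + Delta <= t2 + j2%:R < t1 + j1%:R + Delta + 1 ->
        mu0 * sqnorm x <= bform (F (t2 + j2%:R) - F (t1 + j1%:R)) x x].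
Proof.
have [FA [FA1 FA2 FA3 FA4]] := flow_primitive.
have [FB [FB1 FB2 FB3]] := jump_primitive.
(* Cutting at 0 keeps the arguments of [FA] and [FB] nonnegative, so [F] is monotone and Lipschitz
   on the whole line. *)
pose c v := clock E (Num.max 0 v).
pose b v := Num.max 0 v - c v.
pose F v := (FA (c v) - FA 0) + 2^-1 *: (FB (b v) - FB 0).
have c0 v : 0 <= c v.
  rewrite -(clock0 hE ht E0); apply: clock_ndecr => //.
  by rewrite le_max lexx.
have b0 v : 0 <= b v.
  have : Num.max 0 0 - c 0 <= b v.
    by rewrite /b /c maxxx; apply: clock_lip => //; rewrite le_max lexx.
  by rewrite /c maxxx (clock0 hE ht E0) subrr.
have max_le u v : u <= v -> Num.max 0 u <= Num.max 0 v :> R.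
  by move=> uv; rewrite ge_max !le_max lexx uv/= orbT.
have max_lip u v : u <= v -> Num.max 0 v - Num.max 0 u <= v - u :> R.
  by move=> uv; rewrite /Num.max; do 2 case: ifPn; rewrite -?leNgt; lra.
have cle u v : u <= v -> c u <= c v by move=> /max_le; exact: clock_ndecr.
have ble u v : u <= v -> b u <= b v by move=> /max_le; exact: clock_lip.
have cE t j : E (t, j) -> c (t + j%:R) = t.
  move=> tj; rewrite /c max_r ?(clock_hybrid hE ht tj)//.
  by rewrite addr_ge0// (hybrid_time_ge0 hE tj).
have bE t j : E (t, j) -> b (t + j%:R) = j%:R.
  move=> tj; rewrite /b cE// max_r; first by rewrite addrC addKr.
  by rewrite addr_ge0// (hybrid_time_ge0 hE tj).
have FE t j : E (t, j) -> F (t + j%:R) = (FA t - FA 0) + 2^-1 *: (FB j%:R - FB 0).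
  by move=> tj; rewrite /F cE// bE.
have FBE u v : F v - F u =
    (FA (c v) - FA (c u)) + 2^-1 *: (FB (b v) - FB (b u)).
  rewrite /F opprD addrACA -scalerBr.
  by congr (_ + _ *: _); rewrite opprB addrA subrK.
exists F; split.
  move=> v; have [s1 _] := FA1 _ _ (lexx 0) (c0 v).
  have [s2 _] := FB1 _ _ (lexx 0) (b0 v).
  by rewrite /F linearD linearZ/= s1 s2.
split.
- move=> u v uv; rewrite FBE.
  have [s1 h1] := FA1 _ _ (c0 u) (cle _ _ uv).
  have [s2 h2] := FB1 _ _ (b0 u) (ble _ _ uv).
  split; first by rewrite linearD linearZ/= s1 s2.
  move=> x; rewrite -/(bform _ _ _) bformDm bformZm.
  apply: addr_ge0; first exact: h1.
  by apply: mulr_ge0; [rewrite invr_ge0|exact: h2].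
- move=> u v x uv; rewrite FBE bformDm bformZm.
  have h1 := FA2 _ _ x (c0 u) (cle _ _ uv).
  have h2 := FB2 _ _ x (b0 u) (ble _ _ uv).
  have h3 : (c v - c u) + (b v - b u) <= v - u.
    have := max_lip _ _ uv; rewrite /b; lra.
  have n0 := sqnorm_ge0 x.
  have h4 : 0 <= c v - c u by rewrite subr_ge0 cle.
  have h5 : 0 <= b v - b u by rewrite subr_ge0 ble.
  have h6 : aM * (c v - c u) * sqnorm x <= aM * (v - u) * sqnorm x.
    by rewrite ler_wpM2r// ler_wpM2l//; lra.
  have h7 : 1 * (b v - b u) * sqnorm x <= 1 * (v - u) * sqnorm x.
    by rewrite ler_wpM2r// ler_wpM2l//; lra.
  lra.
- move=> j; have := ae_interior (flow_interval_is_interval hE ht (j := j)).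
  have := FA4 j; apply: filterS2 => t dA tI tj k l.
  apply: (@near_eq_is_derive _ _ _ (fun s =>
    FA s k l + (2^-1 *: (FB j%:R - FB 0) - FA 0) k l)).
    near=> s; have sj : E (s, j) by near: s; exact: tI.
    by rewrite FE// !mxE; ring.
  by have := dA tj k l => dFA; apply: is_derive_eq; rewrite addr0.
- move=> t j tj; have [/= tj0 tj1] := tj.
  by rewrite FBE !cE// !bE// subrr add0r FB3 (Bj_jump tj).
- move=> t1 j1 t2 j2 x E1 E2 /andP[le1 lt1].
  (* The total time increases by at least [Delta > 0], and points of [E] are ordered; hence both
     coordinates are ordered. *)
  have j12 : (j1 <= j2)%N.
    rewrite leqNgt; apply/negP => j21.
    have := hybrid_time_sorted hE ht j21 E2 E1.
    have : j2%:R <= j1%:R :> R by rewrite ler_nat ltnW.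
    have := hDelta; lra.
  have t12 : t1 <= t2.
    move: j12; rewrite leq_eqVlt => /predU1P[j12|j12].
      by move: le1; rewrite j12; have := hDelta; lra.
    exact: (hybrid_time_sorted hE ht j12).
  have := @hPE t1 j1 t2 j2 E1 E2.
  have -> : Delta <= t2 - t1 + (j2%:R - j1%:R) < Delta + 1.
    by apply/andP; split; lra.
  move=> /(_ isT) /psd_leP[_ /(_ x)].
  rewrite (sum_mx_integral hE ht FA3)// FBE !cE// !bE// bform_scalar.
  have -> : \sum_(j1 <= j < j2) B (fine (t_ j.+1)) j = FB j2%:R - FB j1%:R.
    rewrite -(sum_increments j12 FB3); apply: eq_big_nat => j /andP[_ jj2].
    have [eE ei ei1] := jump_time_mem hE ht E2 jj2.
    by rewrite (@Bj_jump (fine (t_ j.+1)))//; split.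
  by [].
Unshelve. all: by end_near. Qed.

End Cumulative.

(** * The Lyapunov function *)

(** Integrating from -1 makes 0 an interior point, so the derivative is two-sided there too. *)
Lemma lipschitz_primitive (R : realType) (f : R -> R) (m : R) :
  (forall u v : R, u <= v -> `|f v - f u| <= m * (v - u)) ->
  forall u : R, 0 <= u ->
  is_derive u 1 (fun y => \int[lebesgue_measure]_(s in `[-1, y]) f s) (f u).
Proof.
move=> lip; have cf : continuous f.
  move=> x; apply/cvgrPdist_le => /= e e0.
  have m1 : 0 < `|m| + 1 by rewrite ltr_wpDl.
  near=> y.
  have H : `|f x - f y| <= m * `|x - y|.
    have [xy|/ltW yx] := leP x y.
      rewrite distrC (distrC x); have -> : `|y - x| = y - x.
        by rewrite ger0_norm// subr_ge0.
      exact: lip.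
    have -> : `|x - y| = x - y by rewrite ger0_norm// subr_ge0.
    exact: lip.
  rewrite (le_trans H)//.
  have h : `|x - y| <= e / (`|m| + 1).
    by near: y; apply: cvgr_dist_le; [exact: cvg_id|rewrite divr_gt0].
  rewrite (@le_trans _ _ ((`|m| + 1) * `|x - y|))//.
    by rewrite ler_wpM2r// (le_trans (ler_norm m))// lerDl.
  by rewrite mulrC -ler_pdivlMr.
move=> u u0.
have i1 : lebesgue_measure.-integrable `[-1, u + 1] (EFin \o f).
  apply: continuous_compact_integrable; first exact: segment_compact.
  by apply: continuous_subspaceT => x; exact: cf.
have uu : u < u + 1 by rewrite ltrDl.
have au : -1 < u by apply: lt_le_trans u0.
have [d1 d2] := continuous_FTC1_closed uu i1 au (cf u).
by apply: DeriveDef; [exact: d1|rewrite -derive1E; exact: d2].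
Unshelve. all: by end_near. Qed.

Lemma is_derive_bform (R : realType) (p : nat) (F G : R -> 'M[R]_p) (u : R) x :
  (forall k l, is_derive u 1 (fun s => F s k l) (G u k l)) ->
  is_derive u 1 (fun s => bform (F s) x x) (bform (G u) x x).
Proof.
move=> dF; rewrite bform_entries.
have -> : (fun s => bform (F s) x x) =
    \sum_k \sum_l ((x k 0 * x l 0) \*: (fun s => F s k l)).
  apply/funext => s; rewrite bform_entries fct_sumE; apply: eq_bigr => k _.
  by rewrite fct_sumE.
by apply: is_derive_sum => k; apply: is_derive_sum => l.
Qed.

(* [rho] is the remaining hybrid time capped at [Delta + 1] (or 0 if [E] is
   unbounded); at [kink] the cap ceases to be active. *)
Lemma remaining_time (R : realType) (E : set (R * nat)) (Delta : R) :
  0 < Delta -> exists (rho : R -> R) (kink : R),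
  [/\ forall t j, E (t, j) -> 0 <= rho (t + j%:R) <= Delta + 1,
      forall u v, u <= v -> rho v <= rho u,
      forall t j, E (t, j) ->
        (exists T J, E (T, J) /\ t + j%:R + Delta <= T + J%:R) \/
        exists L, forall u, t + j%:R - 1 <= u -> rho u = L - u
    & forall u : R, u != kink -> exists2 r, r <= 0 & is_derive u 1 rho r].
Proof.
move=> Delta0; pose X := [set x.1 + x.2%:R | x in E].
have [ubX|ubX] := pselect (has_ubound X); last first.
  exists (cst 0), 0; split.
  - by move=> t j _; rewrite lexx/=; lra.
  - by [].
  - move=> t j tj; left; apply: contrapT => h; apply: ubX.
    exists (t + j%:R + Delta) => _ [[T J] TJ <-] /=.
    rewrite leNgt; apply/negP => h'; apply: h; exists T, J.
    by split => //; rewrite ltW.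
  - by move=> u _; exists 0 => //; exact: is_derive_cst.
pose L := sup X.
have XL t j : E (t, j) -> t + j%:R <= L.
  move=> tj; apply: sup_upper_bound; last by exists (t, j).
  by split => //; exists (t + j%:R), (t, j).
exists (fun u => Num.min (Delta + 1) (L - u)), (L - Delta - 1); split.
- move=> t j /XL tL; rewrite le_min ge_min lexx/= andbT.
  by apply/andP; split; lra.
- by move=> u v uv; rewrite le_min !ge_min lexx/= lerD2l lerN2 uv orbT.
- move=> t j tj.
  have [|h] := pselect (exists T J, E (T, J) /\ t + j%:R + Delta <= T + J%:R).
    by left.
  (* With no point [Delta] further on, L <= t + j + Delta, so the cap [Delta + 1] is inactive from
     one unit before t + j. The jump case needs this extra unit. *)
  right; exists L => u tu; apply/min_idPr.
  have : L <= t + j%:R + Delta.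
    apply: ge_sup; first by exists (t + j%:R), (t, j).
    move=> _ [[T J] TJ <-] /=; rewrite leNgt; apply/negP => h'.
    by apply: h; exists T, J; split => //; rewrite ltW.
  lra.
- move=> u; rewrite neq_lt => /orP[uk|uk].
    exists 0 => //; apply: (@near_eq_is_derive _ _ _ (cst (Delta + 1))).
      near=> v; apply/esym/min_idPl.
      have : v <= L - Delta - 1 by near: v; exact: lt_le_nbhsl.
      lra.
  exists (-1); first by lra.
  apply: (@near_eq_is_derive _ _ _ (fun v => L - v)).
    near=> v; apply/esym/min_idPr.
    have : L - Delta - 1 <= v by near: v; exact: lt_le_nbhsr.
    lra.
  by apply: is_derive_eq; rewrite add0r mul1r.
Unshelve. all: by end_near. Qed.

(** The infimum gives the almost sure bounds a + 1 / (n + 1), and countably many of them are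
    intersected. *)
Lemma ae_le_hybrid_ess_sup (R : realType) (E : set (R * nat)) (f : R -> nat -> R)
    (a : R) : (hybrid_ess_sup E f <= a%:E)%E ->
  forall j, {ae (@lebesgue_measure R), forall t, E (t, j) -> f t j <= a}.
Proof.
move=> fa j.
have : {ae (@lebesgue_measure R), forall t, forall n : nat, E (t, j) ->
    f t j <= a + n.+1%:R^-1}.
  apply: ae_foralln => n.
  have : (hybrid_ess_sup E f < (a + n.+1%:R^-1)%:E)%E.
    by apply: le_lt_trans fa _; rewrite lte_fin ltrDl invr_gt0.
  move=> /ereal_inf_lt[y yE ya]; have := yE j; apply: filterS => t h /h fy.
  by rewrite -lee_fin (le_trans fy)// ltW.
apply: filterS => t h tj; apply/ler_addgt0Pr => e e0.
have [n ne] : exists n : nat, n.+1%:R^-1 < e.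
  exists (Num.truncn e^-1); rewrite invf_plt ?posrE//.
  by have := truncnS_gt e^-1.
by rewrite (le_trans (h n tj))// lerD2l ltW.
Qed.

(** * Decrease along one flow step and across one jump *)

Section Decrease.
Context {R : realType} {p : nat}.
Implicit Types (A B G S : 'M[R]_p) (a s c k : R).

Lemma bform_scalar_mulmx k A x : bform k%:M x (A *m x) = k * bform A x x.
Proof. by rewrite /bform mul_mx_scalar -scalemxAl mulmxA mxE. Qed.

(** [G] is the increment of [F] over the window, so S' = G - D A. Young's inequality with weight 1 /
    (2 D) bounds the cross term 2 x^T S A x by x^T G x / 2 plus 2 D s a x^T A x; the latter and the
    D A in S' are absorbed by -2 k A. *)
Lemma flow_decrease A S G a s c k r alpha D x :
  0 < a -> 0 <= s -> 0 <= c -> 0 < D ->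
  psd A -> (forall y, bform A y y <= a * sqnorm y) ->
  psd S -> (forall y, bform S y y <= s * sqnorm y) ->
  (forall y, bform S y y <= D * bform G y y) ->
  c * alpha <= k -> D + 2 * D * s * a <= 2 * alpha ->
  forall P, P = k%:M - c *: S ->
  bform (r%:M - c *: (G - D *: A) - P *m A - A^T *m P) x x <=
  r * sqnorm x - c / 2 * bform G x x.
Proof.
move=> a0 s0 c0 D0 Apsd Aa Spsd Ss SG ka alphaD P PE.
have sP : P^T = P by rewrite PE linearB linearZ/= tr_scalar_mx (proj1 Spsd).
rewrite !bformBm bformZm bformBm bformZm bform_scalar.
rewrite bform_mull bform_mulr (bformC (A *m x) x sP).
rewrite PE bformBm bformZm bform_scalar_mulmx.
have A0 := proj2 Apsd x; rewrite -/(bform _ _ _) in A0.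
have e0 : 0 < (2 * D)^-1 by rewrite invr_gt0 mulr_gt0.
have cross := bform_cross x (A *m x) e0 Spsd Ss.
have Ax := sqnorm_mulmx_le x a0 Apsd Aa.
have h1 : s * sqnorm (A *m x) <= s * (a * bform A x x) by rewrite ler_wpM2l.
have h2 : 2 * D * (s * sqnorm (A *m x)) <= 2 * D * (s * (a * bform A x x)).
  by rewrite ler_wpM2l// mulr_ge0// ltW.
have h3 : (2 * D)^-1 * bform S x x <= (2 * D)^-1 * (D * bform G x x).
  by rewrite ler_pM2l.
have h4 : (2 * D)^-1 * (D * bform G x x) = bform G x x / 2.
  by field; rewrite gt_eqF.
rewrite invrK in cross.
have h5 : (D + 2 * D * s * a) * bform A x x <= 2 * alpha * bform A x x.
  by rewrite ler_wpM2r.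
have h6 : c * alpha * bform A x x <= k * bform A x x by rewrite ler_wpM2r.
have h7 : c * (2 * bform S x (A *m x)) <=
    c * (bform G x x / 2 + 2 * D * (s * (a * bform A x x))).
  by rewrite ler_wpM2l//; lra.
have h8 : c * ((D + 2 * D * s * a) * bform A x x) <= c * (2 * alpha * bform A x x).
  by rewrite ler_wpM2l.
lra.
Qed.

(** With the same weight 1 / (2 D), the cross term costs w / 2 and 2 D s x^T B x. From B <= I, |x -
    B x|^2 <= |x|^2 - x^T B x: one copy of B is gained where the flow gains two copies of A, hence
    the factor 4. *)
Lemma jump_decrease B S0 S1 s c k0 k1 alpha D w x :
  0 <= s -> 0 <= c -> 0 < D ->
  psd B -> (forall y, bform B y y <= sqnorm y) ->
  psd S1 -> (forall y, bform S1 y y <= s * sqnorm y) ->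
  bform S0 x x - bform S1 x x = D / 2 * bform B x x - w ->
  bform S1 x x <= D * w ->
  c * alpha <= k1 -> D + 4 * D * s <= 2 * alpha ->
  bform ((1%:M - B)^T *m (k1%:M - c *: S1) *m (1%:M - B) -
         (k0%:M - c *: S0)) x x <= (k1 - k0) * sqnorm x - c / 2 * w.
Proof.
move=> s0 c0 D0 Bpsd B1 Spsd Ss S01 Sw ka alphaD.
rewrite bformBm -mulmxA bform_mull bform_mulr mulmxBl mul1mx.
set y := x - B *m x.
rewrite !bformBm !bformZm !bform_scalar.
have B0 := proj2 Bpsd x; rewrite -/(bform _ _ _) in B0.
have sB := proj1 Bpsd.
have Bx : sqnorm (B *m x) <= bform B x x.
  rewrite -[leRHS]mul1r; apply: sqnorm_mulmx_le => // z.
  by rewrite mul1r.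
have yE : sqnorm y = sqnorm x - 2 * bform B x x + sqnorm (B *m x).
  rewrite -[sqnorm y]mul1r -bform_scalar /y.
  rewrite !(bformDl, bformDr, bformNl, bformNr).
  rewrite (bformC (B *m x) x) ?tr_scalar_mx// bform_scalar_mulmx !bform_scalar.
  by ring.
have SyE : bform S1 y y = bform S1 x x - 2 * bform S1 x (B *m x) +
    bform S1 (B *m x) (B *m x).
  rewrite /y !(bformDl, bformDr, bformNl, bformNr).
  by rewrite (bformC (B *m x) x (proj1 Spsd)); ring.
have SB0 := proj2 Spsd (B *m x); rewrite -/(bform _ _ _) in SB0.
have e0 : 0 < (2 * D)^-1 by rewrite invr_gt0 mulr_gt0.
have := bform_cross x (B *m x) e0 Spsd Ss; rewrite invrK => cross.
have h1 : 2 * D * (s * sqnorm (B *m x)) <= 2 * D * (s * bform B x x).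
  by rewrite ler_wpM2l ?mulr_ge0 ?ler_wpM2l// ltW.
have h2 : (2 * D)^-1 * bform S1 x x <= (2 * D)^-1 * (D * w) by rewrite ler_pM2l.
have h3 : (2 * D)^-1 * (D * w) = w / 2 by field; rewrite gt_eqF.
have h4 : c * (2 * bform S1 x (B *m x)) <= c * (w / 2 + 2 * D * (s * bform B x x)).
  by rewrite ler_wpM2l//; lra.
have h5 : c * ((D + 4 * D * s) * bform B x x) <= c * (2 * alpha * bform B x x).
  by rewrite ler_wpM2l// ler_wpM2r.
have a0 : 0 <= alpha.
  have : 0 <= D * s by rewrite mulr_ge0// ltW.
  lra.
have k10 : 0 <= k1 by rewrite (le_trans _ ka)// mulr_ge0.
have h6 : k1 * sqnorm (B *m x) <= k1 * bform B x x by rewrite ler_wpM2l.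
have h7 : c * alpha * bform B x x <= k1 * bform B x x by rewrite ler_wpM2r.
have h8 : 0 <= c * bform S1 (B *m x) (B *m x) by rewrite mulr_ge0.
rewrite yE SyE; have -> : bform S0 x x = bform S1 x x + D / 2 * bform B x x - w.
  by lra.
lra.
Qed.

End Decrease.

(** * The windowed integral as a matrix *)

Section Window.
Context {R : realType} {p : nat}.
Variables (F : R -> 'M[R]_p) (m D : R).
Hypothesis F_sym : forall v, (F v)^T = F v.
Hypothesis F_psd : forall u v, u <= v -> psd (F v - F u).
Hypothesis F_le : forall u v x, u <= v ->
  bform (F v - F u) x x <= m * (v - u) * sqnorm x.
Hypothesis D1 : 1 <= D.

Definition antiderivative (u : R) : 'M[R]_p :=
  \matrix_(k, l) \int[lebesgue_measure]_(s in `[-1, u]) F s k l.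

(* [window_mx u] is the integral of [F v - F u] over [u, u + D], that is, of
   [(u + D - v) dF v]. *)
Definition window_mx (u : R) : 'M[R]_p :=
  antiderivative (u + D) - antiderivative u - D *: F u.

Lemma antiderivative_derive (u : R) k l : 0 <= u ->
  is_derive u 1 (fun s => antiderivative s k l) (F u k l).
Proof.
move=> u0.
have -> : (fun s => antiderivative s k l) =
    (fun y => \int[lebesgue_measure]_(s in `[-1, y]) F s k l).
  by apply/funext => y; rewrite mxE.
apply: (@lipschitz_primitive R (fun s => F s k l) m) u0 => v w vw.
have := psd_entry_le k l (F_psd vw) (fun x => F_le x vw).
by rewrite !mxE.
Qed.

Let f x u := bform (F u) x x.
Let h x u := bform (antiderivative u) x x.

Let hf x (u : R) : 0 <= u -> is_derive u 1 (h x) (f x u).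
Proof.
by move=> u0; apply: is_derive_bform => k l; exact: antiderivative_derive.
Qed.

Let f_ndecr x (u v : R) : 0 <= u -> u <= v -> f x u <= f x v.
Proof.
move=> _ uv; rewrite -subr_ge0 -bformBm.
by have [_] := F_psd uv; apply.
Qed.

Let f_lip x (u v : R) : 0 <= u -> u <= v -> f x v - f x u <= m * sqnorm x * (v - u).
Proof. by move=> _ uv; rewrite -bformBm mulrAC F_le. Qed.

Lemma bform_window_mx x u : bform (window_mx u) x x = window (f x) (h x) D u.
Proof. by rewrite /window_mx !bformBm bformZm. Qed.

Lemma window_mx_psd (u : R) : 0 <= u -> psd (window_mx u).
Proof.
move=> u0; split.
  have sym v : (antiderivative v)^T = antiderivative v.
    apply/matrixP => k l; rewrite !mxE; apply: eq_Rintegral => s _.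
    by rewrite -[in LHS]F_sym mxE.
  by rewrite /window_mx !linearB linearZ/= !sym F_sym.
move=> x; rewrite -/(bform _ _ _) bform_window_mx.
exact: (window_ge0 (hf x) (@f_ndecr x) D1 u0).
Qed.

Lemma window_mx_le (u : R) x : 0 <= u ->
  bform (window_mx u) x x <= (m * D ^+ 2 / 2) * sqnorm x.
Proof.
move=> u0; rewrite bform_window_mx.
have := window_le (hf x) (@f_lip x) D1 u0; lra.
Qed.

Lemma window_mx_le_increment (u : R) x : 0 <= u ->
  bform (window_mx u) x x <= D * bform (F (u + D) - F u) x x.
Proof.
move=> u0; rewrite bform_window_mx bformBm.
exact: (window_le_increment (hf x) (@f_ndecr x) D1 u0).
Qed.

Lemma window_mx_jump (u : R) x : 0 <= u -> exists w,
  [/\ bform (window_mx u) x x - bform (window_mx (u + 1)) x x =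
        D * bform (F (u + 1) - F u) x x - w,
      bform (window_mx (u + 1)) x x <= D * w
    & bform (F (u + D) - F (u + 1)) x x <= w].
Proof.
move=> u0; exists (mean_increment (h x) D u); split.
- by rewrite !bform_window_mx (window_diff (f x)) bformBm.
- rewrite bform_window_mx.
  exact: (window_le_mean_increment (hf x) (@f_ndecr x) D1 u0).
- rewrite bformBm.
  exact: (mean_increment_ge (hf x) (@f_ndecr x) D1 u0).
Qed.

End Window.

Lemma is_derive_shift (R : realType) (f : R -> R) (t b a : R) :
  is_derive (t + b) 1 f a -> is_derive t 1 (fun s => f (s + b)) a.
Proof.
move=> df; rewrite -[a]mulr1.
apply: (@is_derive1_comp R f (fun s => s + b)) => //.
by apply: is_derive_eq; rewrite addr0.
Qed.

Lemma derive1_mx (R : realType) (p : nat) (M : R -> 'M[R]_p) (t : R) (dM : 'M[R]_p) :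
  (forall k l, is_derive t 1 (fun s => M s k l) (dM k l)) ->
  derivable M t 1 /\ derive1 M t = dM.
Proof.
move=> h; have dMt : derivable M t 1.
  by apply/derivable_mxP => k l; have [] := h k l.
split=> //; rewrite derive1E derive_mx//.
by apply/matrixP => k l; rewrite mxE; have [_ ->] := h k l.
Qed.

Lemma trmx_symB (R : realType) (p : nat) (M N : 'M[R]_p) :
  M^T = M -> N^T = N -> (M - N)^T = M - N.
Proof. by move=> sM sN; rewrite linearB/= sM sN. Qed.

Theorem lemmaB3 (R : realType) (p : nat) (E : set (R * nat))
  (t_ : nat -> \bar R) (A B : R -> nat -> 'M[R]_p) (aM Delta mu0 : R)
  (hE : hybrid_time_domain E)
  (ht : jump_times E t_)
  (* implicit in the integrals of (ii) *)
  (hAmeas : forall (j : nat) (k l : 'I_p),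
     lebesgue_measurable_fun (flow_interval E j) (fun t => A t j k l))
  (hA : forall t j, E (t, j) -> (A t j)^T = A t j /\ psd_le 0 (A t j))
  (hB : forall t j, jump_set E (t, j) -> (B t j)^T = B t j /\ psd_le 0 (B t j))
  (haM : 0 < aM)
  (hAM : (hybrid_ess_sup E (fun t j => spectral_norm (A t j)) <= aM%:E)%E)
  (hB1 : forall t j, jump_set E (t, j) -> spectral_norm (B t j) < 1)
  (hDelta : 0 < Delta) (hmu0 : 0 < mu0)
  (hPE : persistently_exciting E t_ A B Delta mu0)
  (* kappa0 and lambda0 are well defined; this follows from the other
     hypotheses as soon as 0 < p and E contains a pair of hybrid times to which
     hPE applies *)
  (hsigma : sigma aM Delta mu0 < 1) :
  forall (qm qM : R), 0 < qm -> qm <= qM ->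
  forall Q : R -> nat -> 'M[R]_p,
    (forall t j, E (t, j) ->
       [/\ (Q t j)^T = Q t j, psd_le (qm%:M) (Q t j) & psd_le (Q t j) (qM%:M)]) ->
  exists P : R -> nat -> 'M[R]_p,
    [/\ forall t j, E (t, j) ->
          [/\ (P t j)^T = P t j, psd_le (qm%:M) (P t j)
            & psd_le (P t j) ((p_M aM Delta mu0 qm qM)%:M)],
        forall j : nat,
          {ae (@lebesgue_measure R), forall t : R, flow_interval E j t ->
             derivable (fun s : R => P s j) t 1 /\
             psd_le (derive1 (fun s : R => P s j) t
                       - P t j *m A t j - (A t j)^T *m P t j)
                    (- Q t j)}
      & forall t j, jump_set E (t, j) ->
          psd_le ((1%:M - B t j)^T *m P t j.+1 *m (1%:M - B t j) - P t j)
                 (- Q t j)].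
Proof.
move=> qm qM qm0 qmM Q hQ.
(* The clock, and with it [F], presupposes a point of [E]. *)
have [E0|E0] := pselect (E !=set0); last first.
  exists (fun _ _ => 0); split.
  - by move=> t j tj; case: E0; exists (t, j).
  - by move=> j; apply: aeW => t tj; case: E0; exists (t, j).
  - by move=> t j [tj _]; case: E0; exists (t, j).
have qM0 : 0 < qM := lt_le_trans qm0 qmM.
have hA' j : {ae (@lebesgue_measure R), forall t, flow_interval E j t ->
    psd (A t j) /\ forall x, bform (A t j) x x <= aM * sqnorm x}.
  have := ae_le_hybrid_ess_sup hAM j; apply: filterS => t h tj.
  split; first by have [_] := hA t j tj; rewrite /psd_le subr0.
  by move=> x; apply: spectral_norm_bform; exact: h.
have hB' t j : jump_set E (t, j) ->
    psd (B t j) /\ forall x, bform (B t j) x x <= sqnorm x.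
  move=> tj; split; first by have [_] := hB t j tj; rewrite /psd_le subr0.
  move=> x; rewrite -[leRHS]mul1r; apply: spectral_norm_bform.
  by apply: ltW; exact: hB1.
have [F [F_sym [F_psd F_le dF F_jump F_exc]]] :=
  cumulative_excitation hE ht hAmeas (ltW haM) hA' hB' hDelta hPE E0.
have [rho [kink [rho_bnd rho_ndecr rho_end drho]]] := remaining_time E hDelta.
pose m := aM + 1 / 2; pose D := Delta + 2; pose s := m * D ^+ 2 / 2.
pose alpha := lyapunov_offset aM Delta; pose c := 2 * qM / mu0.
pose S := window_mx F D.
pose k v := qm + qM * rho v + c * alpha.
pose P v := (k v)%:M - c *: S v.
have D2 : 2 < D by rewrite /D; lra.
have D1 : 1 <= D by lra.
have m0 : 0 < m by rewrite /m; lra.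
have c0 : 0 < c by rewrite divr_gt0// mulr_gt0.
have c2 : 0 <= c / 2 by rewrite divr_ge0// ltW.
have s0 : 0 <= s by rewrite /s divr_ge0// mulr_ge0 ?sqr_ge0// ltW.
have D3m : 0 < D ^+ 3 * m by rewrite mulr_gt0// exprn_gt0//; lra.
have alphaE : 2 * alpha = D + D ^+ 3 * m * aM + 2 * (D ^+ 3 * m).
  by rewrite /alpha /lyapunov_offset -/D -/m; field.
have D3ma : 0 < D ^+ 3 * m * aM by rewrite mulr_gt0.
have alpha_flow : D + 2 * D * s * aM <= 2 * alpha.
  have -> : 2 * D * s * aM = D ^+ 3 * m * aM by rewrite /s; field.
  by rewrite alphaE; lra.
have alpha_jump : D + 4 * D * s <= 2 * alpha.
  have -> : 4 * D * s = 2 * (D ^+ 3 * m) by rewrite /s; field.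
  by rewrite alphaE; lra.
have s_alpha : s <= alpha.
  have : s <= D * s by rewrite ler_peMl.
  lra.
have S_psd v : 0 <= v -> psd (S v) := @window_mx_psd _ _ F m D F_sym F_psd F_le D1 v.
have S_le v x : 0 <= v -> bform (S v) x x <= s * sqnorm x :=
  @window_mx_le _ _ F m D F_psd F_le D1 v x.
have P_sym v : 0 <= v -> (P v)^T = P v.
  by move=> /S_psd[sS _]; rewrite /P linearB linearZ/= sS tr_scalar_mx.
have tj_ge0 t j : E (t, j) -> 0 <= t + j%:R.
  by move=> tj; rewrite addr_ge0// (hybrid_time_ge0 hE tj).
have k_ge t j : E (t, j) -> c * alpha <= k (t + j%:R).
  move=> /rho_bnd/andP[rho0 _]; rewrite /k.
  have : 0 <= qM * rho (t + j%:R) by rewrite mulr_ge0// ltW.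
  lra.
have Q_le t j x : E (t, j) -> bform (Q t j) x x <= qM * sqnorm x.
  by move=> /hQ[_ _ /psd_leP[_ /(_ x)]]; rewrite bform_scalar.
have excited t j : E (t, j) ->
  (forall x, mu0 * sqnorm x <=
     bform (F (t + j%:R + (Delta + 1)) - F (t + j%:R)) x x) \/
  exists L, forall u, t + j%:R - 1 <= u -> rho u = L - u.
  move=> tj; have [[T [J [TJ le1]]]|h] := rho_end t j tj; [left|by right] => x.
  (* The first hybrid time at or after t + j + Delta comes less than one unit later, so (ii) applies
     to it; monotonicity of [F] extends the bound to t + j + Delta + 1. *)
  have [|T' [J' [TJ' /andP[le2 lt2]]]] := hybrid_time_next hE ht TJ _ le1.
    by rewrite addr_ge0 ?tj_ge0// ltW.
  apply: (le_trans (F_exc t j T' J' x tj TJ' _)); first by rewrite le2.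
  have le3 : T' + J'%:R <= t + j%:R + (Delta + 1) by lra.
  have [_ /(_ x)] := F_psd _ _ le3; rewrite -/(bform _ _ _) !bformBm; lra.
have final g (x : 'cV[R]_p) : mu0 * sqnorm x <= g -> qM * sqnorm x <= c / 2 * g.
  move=> h; have -> : c / 2 * g = qM * (g / mu0).
    by rewrite /c; field; rewrite gt_eqF.
  by rewrite ler_pM2l// ler_pdivlMr// mulrC.
exists (fun t j => P (t + j%:R)); split.
- move=> t j tj; have tj0 := tj_ge0 _ _ tj.
  have /andP[rho0 rho1] := rho_bnd t j tj.
  have qrho0 : 0 <= qM * rho (t + j%:R) by rewrite mulr_ge0// ltW.
  have qrho1 : qM * rho (t + j%:R) <= qM * (Delta + 1) by rewrite ler_pM2l.
  have pM := p_M_ge qm haM hDelta hmu0 hsigma qM0.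
  rewrite -/c -/alpha in pM.
  split; first exact: P_sym.
  + apply/psd_leP; split; first by rewrite linearB/= P_sym// tr_scalar_mx.
    move=> x; rewrite /P bformBm bformZm !bform_scalar.
    have h1 : c * bform (S (t + j%:R)) x x <= c * (alpha * sqnorm x).
      rewrite ler_pM2l// (le_trans (S_le _ _ tj0))//.
      by rewrite ler_wpM2r// sqnorm_ge0.
    have h2 : 0 <= qM * rho (t + j%:R) * sqnorm x.
      by rewrite mulr_ge0// sqnorm_ge0.
    rewrite /k; lra.
  + apply/psd_leP; split; first by rewrite linearB/= P_sym// tr_scalar_mx.
    move=> x; rewrite /P bformBm bformZm !bform_scalar.
    have h1 : 0 <= c * bform (S (t + j%:R)) x x.
      by rewrite mulr_ge0//; [exact: ltW|exact: (proj2 (S_psd _ tj0))].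
    have h2 : k (t + j%:R) * sqnorm x <= p_M aM Delta mu0 qm qM * sqnorm x.
      by rewrite ler_wpM2r ?sqnorm_ge0// (le_trans _ pM)// /k; lra.
    lra.
- move=> j.
  have nkink : {ae (@lebesgue_measure R), forall t : R, t + j%:R != kink}.
    have : (@lebesgue_measure R).-negligible [set kink - j%:R].
      by apply/negligibleP => //; exact: lebesgue_measure_set1.
    apply: negligibleS => t /= /negP; rewrite negbK => /eqP <-.
    by rewrite addrK.
  move: nkink (dF j) (hA' j); apply: filterS3 => t nk dFt At tj.
  have u0 := tj_ge0 _ _ tj; set u := t + j%:R in nk u0.
  have [Apsd Aa] := At tj; have [r r0 dr] := drho _ nk.
  (* In general only r <= 0 is known; near the end of the domain uniqueness of derivatives gives the
     exact rate. *)
  have r_end L : (forall v, u - 1 <= v -> rho v = L - v) -> r = -1.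
    move=> HL; have d1 : is_derive u 1 rho (-1).
      apply: (@near_eq_is_derive _ _ _ (fun v => L - v)).
        near=> v; rewrite HL//; near: v; apply: lt_le_nbhsr; lra.
      by apply: is_derive_eq; rewrite add0r mul1r.
    by have [_ <-] := d1; have [_ ->] := dr.
  pose dP := (qM * r)%:M - c *: ((F (u + D) - F u) - D *: A t j).
  have dPE i l : is_derive t 1 (fun v => P (v + j%:R) i l) (dP i l).
    have d1 := is_derive_shift dr.
    have uD : 0 <= u + D by lra.
    have d2 := is_derive_shift (is_derive_shift
      (antiderivative_derive F_psd F_le i l uD)).
    have d3 := is_derive_shift (antiderivative_derive F_psd F_le i l u0).
    have d4 := dFt tj i l.
    have -> : (fun v => P (v + j%:R) i l) = (fun v =>
        (qm + qM * rho (v + j%:R) + c * alpha) * (i == l)%:R -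
        c * (antiderivative F (v + j%:R + D) i l -
             antiderivative F (v + j%:R) i l - D * F (v + j%:R) i l)).
      by apply/funext => v; rewrite /P /k /S /window_mx !mxE mulr_natr.
    apply: is_derive_eq; rewrite !mxE -mulr_natr /GRing.scale/=; ring.
  have [dPt ->] := derive1_mx dPE; split => //.
  apply/psd_leP; split.
    have sQ : (Q t j)^T = Q t j by have [] := hQ t j tj.
    have [sA _] := Apsd.
    apply: trmx_symB; first by rewrite linearN/= sQ.
    rewrite -addrA -opprD; apply: trmx_symB.
      apply: trmx_symB; first exact: tr_scalar_mx.
      rewrite linearZ/=; congr (_ *: _); apply: trmx_symB.
        exact: trmx_symB.
      by rewrite linearZ/= sA.
    by rewrite !sA linearD/= !trmx_mul sA P_sym// addrC.
  move=> x; rewrite bformNm.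
  have S_inc y : bform (S u) y y <= D * bform (F (u + D) - F u) y y.
    exact: (window_mx_le_increment F_psd F_le D1 y u0).
  have FD := @flow_decrease R p (A t j) (S u) (F (u + D) - F u) aM s c (k u)
    (qM * r) alpha D x haM s0 (ltW c0) (lt_le_trans ltr01 D1) Apsd Aa
    (S_psd _ u0) (fun y => S_le _ y u0) S_inc (k_ge _ _ tj) alpha_flow
    (P u) (erefl _).
  apply: (le_trans FD).
  have uD : u + (Delta + 1) <= u + D by rewrite /D; lra.
  have F1 := proj2 (F_psd _ _ uD) x; rewrite -/(bform _ _ _) in F1.
  have uD' : u <= u + D by lra.
  have F0 := proj2 (F_psd _ _ uD') x; rewrite -/(bform _ _ _) in F0.
  have Qx := Q_le _ _ x tj; have n0 := sqnorm_ge0 x.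
  (* Either the excitation supplies the decrease qM |x|^2, or [rho] does with slope -1. *)
  have [exc|[L /r_end ->]] := excited _ _ tj.
    have h1 : mu0 * sqnorm x <= bform (F (u + D) - F u) x x.
      by apply: le_trans (exc x) _; move: F1; rewrite !bformBm -/u; lra.
    have := final _ _ h1.
    have : qM * r * sqnorm x <= 0 by rewrite mulr_le0_ge0// mulr_ge0_le0// ltW.
    lra.
  have : 0 <= c / 2 * bform (F (u + D) - F u) x x.
    by rewrite mulr_ge0.
  lra.
- move=> t j tj; have [/= tj0 tj1] := tj.
  have u0 := tj_ge0 _ _ tj0; set u := t + j%:R in u0 *.
  have uE : t + j.+1%:R = u + 1 by rewrite -natr1 addrA.
  have [Bpsd B1] := hB' t j tj.
  have u10 : 0 <= u + 1 by lra.
  rewrite uE; apply/psd_leP; split.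
    have sQ : (Q t j)^T = Q t j by have [] := hQ t j tj0.
    apply: trmx_symB; first by rewrite linearN/= sQ.
    apply: trmx_symB; last exact: P_sym.
    by rewrite !trmx_mul trmxK P_sym// mulmxA.
  move=> x; rewrite bformNm.
  have [w [w1 w2 w3]] := window_mx_jump F_psd F_le D1 x u0.
  rewrite -uE (F_jump _ _ tj) uE bformZm mulrA in w1.
  have kk : c * alpha <= k (u + 1) by rewrite -uE; exact: k_ge.
  have JD := @jump_decrease R p (B t j) (S u) (S (u + 1)) s c (k u) (k (u + 1))
    alpha D w x s0 (ltW c0) (lt_le_trans ltr01 D1) Bpsd B1 (S_psd _ u10)
    (fun y => S_le _ y u10) w1 w2 kk alpha_jump.
  apply: (le_trans JD).
  have := Q_le _ _ x tj0.
  have -> : k (u + 1) - k u = qM * (rho (u + 1) - rho u) by rewrite /k; ring.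
  have n0 := sqnorm_ge0 x.
  (* The alternative is taken at the landing point: its excitation over [u + 1, u + D] is bounded by
     [w]; otherwise [rho] drops by exactly 1 from u to u + 1. *)
  have [exc|[L HL]] := excited _ _ tj1.
    have := exc x; rewrite uE.
    have -> : u + 1 + (Delta + 1) = u + D by rewrite /D; ring.
    move=> /le_trans/(_ w3)/final h1.
    have : qM * (rho (u + 1) - rho u) * sqnorm x <= 0.
      have rd : rho (u + 1) - rho u <= 0.
        by rewrite subr_le0; apply: rho_ndecr; lra.
      by rewrite mulr_le0_ge0// mulr_ge0_le0// ltW.
    lra.
  have w0 : 0 <= c / 2 * w.
    rewrite mulr_ge0//; apply: le_trans w3.
    have uD : u + 1 <= u + D by lra.
    by have [_] := F_psd _ _ uD; apply.
  rewrite !HL; rewrite ?uE; [|lra|lra].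
  lra.
Unshelve. all: by end_near. Qed.
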